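(* Let $h\geq 2$ be a fixed integer and let $x_0>0$ be (arbitrarily large but) fixed. Let $f:[x_0,+\infty)\to(0,+\infty)$ be a locally integrable positive real function such that (i) $\displaystyle\int_{x_0}^x \frac{f(t)}{t}\,dt=\Theta(f(x))$; (ii) $x^{1/h}\log(x)^{1/h}\ll f(x)\ll x^{1/(h-1)-\varepsilon}$ for some $\varepsilon>0$. Then there is an $h$-basis $\mathscr{A}\subseteq\mathbb{N}$ with $A(x)=\Theta(f(x))$ such that $$r_{\mathscr{A},h+\ell}(n)=\Theta\left(\frac{f(n)^{h+\ell}}{n}\right)\quad\text{for every integer }\ell\geq 0.$$ Furthermore, when $h=2$, the same conclusion holds if, in place of (ii), $f$ satisfies $x^{1/2}\log(x)^{1/2}\ll f(x)\ll x$ (condition (i) still being assumed).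
   Context: $\mathbb{N}$ is the set of natural numbers including $0$. A sequence $\mathscr{A}$ is an infinite subset of $\mathbb{N}$, with counting function $A(x)=|\mathscr{A}\cap[0,x]|$. For $h\ge 1$, $r_{\mathscr{A},h}(n)$ is the number of ordered $h$-tuples $(k_1,\dots,k_h)\in\mathscr{A}^h$ with $k_1+\cdots+k_h=n$. The $h$-fold sumset is $h\mathscr{A}=\{k_1+\cdots+k_h: k_i\in\mathscr{A}\}$. $\mathscr{A}$ is an additive basis if $h\mathscr{A}=\mathbb{N}$ for some $h\geq 2$; the least such $h\ge 2$ is its order; an $h$-basis is an additive basis of order $h$. The asymptotic symbols are taken as $x\to+\infty$ through the reals or $n\to+\infty$ through $\mathbb{N}$: $f\ll g$ means $f=O(g)$, and $f=\Theta(g)$ means $f\ll g$ and $g\ll f$; the implied constants in the conclusion may depend on $\ell$. *)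

(* Defs.v *)
From HB Require Import structures.
From mathcomp Require Import all_boot all_order all_algebra finmap.
From mathcomp Require Import all_classical all_reals all_analysis.

Set Implicit Arguments.
Unset Strict Implicit.
Unset Printing Implicit Defensive.

Import Order.TTheory GRing.Theory Num.Theory.
Import numFieldNormedType.Exports.

Local Open Scope classical_set_scope.
Local Open Scope ring_scope.

Definition representations (A : set nat) (h n : nat) : set (h.-tuple nat) :=
  [set k | (forall i, A (tnth k i)) /\ (\sum_(i < h) tnth k i)%N = n].
Arguments representations : clear implicits.

Definition sumset (h : nat) (A : set nat) : set nat :=
  [set n | representations A h n !=set0].

(* [#|` fset_set X|] is the cardinality of [X] when [X] is finite and a junk
   value otherwise; the sets counted by [rep_count] and [counting_function]
   are always finite. *)
Definition rep_count (A : set nat) (h n : nat) : nat :=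
  #|` fset_set (representations A h n)|.

Definition counting_function (R : realType) (A : set nat) (x : R) : nat :=
  #|` fset_set (A `&` [set k | k%:R <= x])|.

(* [A] is an additive basis whose order is exactly [h]. *)
Definition basis_of_order (h : nat) (A : set nat) : Prop :=
  [/\ infinite_set A, (2 <= h)%N, sumset h A = setT &
      forall k : nat, (2 <= k < h)%N -> sumset k A <> setT].

(* Unlike [locally_integrable], the domain need not be open (it is used on
   [[x0, +oo[]) and [f] is Lebesgue rather than Borel measurable. *)
Definition locally_integrable_on (R : realType) (D : set R) (f : R -> R) : Prop :=
  forall K : set R, K `<=` D -> compact K ->
    completed_lebesgue_measure.-integrable K (EFin \o f).

(* Needed for [=O_] and [=Theta_] to accept [+oo]; the library only declares
   the filter [\oo] on [nat] as canonical. *)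
Canonical pinfty_filter_on (R : numFieldType) := FilterType (pinfty_nbhs R) _.

(* Main.v *)
Require Import Defs.
From HB Require Import structures.
From mathcomp Require Import all_boot all_order all_algebra finmap.
From mathcomp Require Import all_classical all_reals all_analysis.
From mathcomp Require Import measurable_realfun.
From mathcomp Require Import zify ring lra.

Set Implicit Arguments.
Unset Strict Implicit.
Unset Printing Implicit Defensive.

Import Order.TTheory GRing.Theory Num.Theory.
Import numFieldNormedType.Exports.

Local Open Scope classical_set_scope.
Local Open Scope ring_scope.

(* With F(x) = int_{x0}^x f(t)/t dt, hypothesis (i) makes F comparable to f,
   nondecreasing, and such that F(2x)/F(x) lies between two constants greater
   than 1. Let G be the minimum of n and a large multiple of F, and let n be
   chosen with probability p_n = G(n)/n. Then r_h(n) should be of order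
   G(n)^h/n, which dominates log n.

   The choice is derandomised. If a is the indicator of the set and U_k
   depends only on the set below k, then
     exp (sum_{i<k} (a_i U_i - p_i (e^{U_i} - 1)))
   has nonincreasing mean when a_i is chosen with probability p_i. Deciding
   one k at a time, a whole family of such quantities, weighted by n^-2, is kept
   bounded by 1; each gives a Chernoff bound with error 2 log n. Here U_k is
   a multiple of the increment of r_j(n) caused by inserting k above the
   elements already chosen, truncated at a bound for r_{j-1}. For j < h,
   sparsity and the slope eta log n give r_j = O(1) by induction on j, with a
   constant not depending on the multiple of F, so that for j = h the
   slope can be constant and both tails are controlled.

   Adding an initial segment to the set makes it a basis and changes r_h by O(1).
   More summands are handled deterministically: a representation with h + 1
   summands has one of size at most n/(h + 1), hence r_{h+1}(n) is at most
   (h + 1) A(n) max r_h over [n/2, n]. *)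

(** * Representation functions as coefficients of powers of generating polynomials *)

(* Order hypotheses over [R] and universally quantified ones make [lia] slow. *)
Ltac natlia :=
  repeat match goal with
  | H : is_true (@Order.le _ _ _ _) |- _ => clear H
  | H : is_true (@Order.lt _ _ _ _) |- _ => clear H
  | H : forall _, _ |- _ => clear H
  end; lia.

Section Representations.
Variable R : realFieldType.
Implicit Types (b c s : nat -> bool) (p q : {poly R}).

Definition gen_poly N b : {poly R} := \poly_(i < N) (b i)%:R.

(** Cutting the generating series at degree [n] leaves its coefficients up to [n] unchanged, so this
    counts ordered representations of [n]. *)
Definition rep b j n : R := (gen_poly n.+1 b ^+ j)`_n.

Definition cnt b n : R := \sum_(i < n.+1) (b i)%:R.

Lemma coef_gen_poly N b i :
  (gen_poly N b)`_i = if (i < N)%N then (b i)%:R else 0.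
Proof. by rewrite coef_poly. Qed.

Lemma gen_poly_ge0 N b i : 0 <= (gen_poly N b)`_i.
Proof. by rewrite coef_gen_poly; case: ifP. Qed.

Lemma coefM_ge0 p q i :
  (forall k, 0 <= p`_k) -> (forall k, 0 <= q`_k) -> 0 <= (p * q)`_i.
Proof. by move=> p0 q0; rewrite coefM sumr_ge0 // => k _; rewrite mulr_ge0. Qed.

Lemma coefX_ge0 p j i : (forall k, 0 <= p`_k) -> 0 <= (p ^+ j)`_i.
Proof.
move=> p0; elim: j i => [|j IH] i; first by rewrite expr0 coef1 ler0n.
by rewrite exprS coefM_ge0.
Qed.

Lemma coefM_le n p p' q q' :
  (forall i, 0 <= p`_i) -> (forall i, 0 <= q`_i) ->
  (forall i, (i <= n)%N -> p`_i <= p'`_i) ->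
  (forall i, (i <= n)%N -> q`_i <= q'`_i) ->
  forall i, (i <= n)%N -> (p * q)`_i <= (p' * q')`_i.
Proof.
move=> p0 q0 pp qq i ni; rewrite !coefM ler_sum // => k _.
have kn : (k <= n)%N by rewrite (leq_trans _ ni) // -ltnS.
by rewrite ler_pM ?pp ?qq // (leq_trans (leq_subr _ _)).
Qed.

Lemma coefX_le n p p' j :
  (forall i, 0 <= p`_i) -> (forall i, (i <= n)%N -> p`_i <= p'`_i) ->
  forall i, (i <= n)%N -> (p ^+ j)`_i <= (p' ^+ j)`_i.
Proof.
move=> p0 pp; elim: j => [|j IH] i ni; first by rewrite !expr0.
by rewrite !exprS (@coefM_le n) // => k; rewrite coefX_ge0.
Qed.

Lemma coefX_gen_poly N b j n :
  (n < N)%N -> (gen_poly N b ^+ j)`_n = rep b j n.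
Proof.
move=> nN; apply/le_anti/andP; split; apply: (@coefX_le n) => // i;
  rewrite ?gen_poly_ge0 // => ni; rewrite !coef_gen_poly ltnS ni;
  by rewrite (leq_ltn_trans ni nN).
Qed.

Lemma rep_ge0 b j n : 0 <= rep b j n.
Proof. by apply: coefX_ge0 => k; apply: gen_poly_ge0. Qed.

Lemma rep0 b n : rep b 0 n = (n == 0)%:R.
Proof. by rewrite /rep expr0 coef1. Qed.

Lemma rep1 b n : rep b 1 n = (b n)%:R.
Proof. by rewrite /rep expr1 coef_gen_poly ltnSn. Qed.

Lemma rep_mono b c j n :
  (forall i, (i <= n)%N -> b i -> c i) -> rep b j n <= rep c j n.
Proof.
move=> bc; apply: (@coefX_le n) => // i; rewrite ?gen_poly_ge0 // => ni.
rewrite !coef_gen_poly ltnS ni ler_nat.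
by move: (bc i ni); case: (b i) => // ->.
Qed.

Lemma eq_rep b c j n :
  (forall i, (i <= n)%N -> b i = c i) -> rep b j n = rep c j n.
Proof.
by move=> bc; apply/le_anti/andP; split; apply: rep_mono => i ni; rewrite bc.
Qed.

Lemma rep_gt_support b j k n :
  (forall i, b i -> (i <= k)%N) -> (j * k < n)%N -> rep b j n = 0.
Proof.
move=> bk jkn; apply/le_anti/andP; split; last exact: rep_ge0.
have -> : 0 = (gen_poly k.+1 b ^+ j)`_n :> R.
  rewrite nth_default // (leq_trans (size_poly_exp_leq _ _)) //.
  rewrite (leq_trans _ jkn) // ltnS mulnC leq_mul2l; apply/orP; right.
  by have := size_poly k.+1 (fun i => (b i)%:R : R); rewrite -/(gen_poly _ _); lia.
apply: (@coefX_le n) => // i; rewrite ?gen_poly_ge0 // => ni.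
rewrite !coef_gen_poly ltnS ni ltnS; case: ifP => // ik.
by case: (boolP (b i)) => // /bk; rewrite ik.
Qed.

(** The generating polynomial is divisible by ['X^k], so its [j]-th power has no coefficient below
    [j * k]. *)
Lemma rep_lt_support b j k n :
  (forall i, b i -> (k <= i)%N) -> (n < j * k)%N -> rep b j n = 0.
Proof.
move=> bk jkn; apply/le_anti/andP; split; last exact: rep_ge0.
have -> : 0 = (('X^k * gen_poly n.+1 (fun i => b (i + k)%N)) ^+ j)`_n :> R.
  by rewrite exprMn -exprM coefXnM mulnC jkn.
apply: (@coefX_le n) => // i; rewrite ?gen_poly_ge0 // => ni.
rewrite coefXnM !coef_gen_poly ltnS ni; case: ifP => ik.
  by case: (boolP (b i)) => // /bk; rewrite leqNgt ik.
by rewrite ltnS (leq_trans (leq_subr _ _)) // subnK // leqNgt ik.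
Qed.

Lemma coef_gen_polyM N b c j n : (n < N)%N ->
  (gen_poly N b * gen_poly N c ^+ j)`_n =
  \sum_(k < n.+1) (b k)%:R * rep c j (n - k).
Proof.
move=> nN; rewrite coefM; apply: eq_bigr => k _.
rewrite coef_gen_poly (leq_trans (ltn_ord k) nN) coefX_gen_poly //.
exact: leq_ltn_trans (leq_subr _ _) nN.
Qed.

Lemma repS b j n :
  rep b j.+1 n = \sum_(k < n.+1) (b k)%:R * rep b j (n - k).
Proof. by rewrite -(@coef_gen_polyM n.+1) // -exprS. Qed.

Section Split.
Variables (b s c : nat -> bool).
Hypothesis cE : forall i, c i = b i || s i.
Hypothesis disj : forall i, ~~ (b i && s i).

Let gE N : gen_poly N c = gen_poly N b + gen_poly N s.
Proof.
apply/polyP => i; rewrite coefD !coef_gen_poly; case: ifP => _; last by rewrite addr0.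
by rewrite cE; move: (disj i); case: (b i); case: (s i); rewrite ?addr0 ?add0r.
Qed.

(** Factorisation of a difference of two powers [j.+1], whose bases differ by the generating
    polynomial of [s]. *)
Let diff j n : rep c j.+1 n - rep b j.+1 n =
  \sum_(i < j.+1) (gen_poly n.+1 s * (gen_poly n.+1 c ^+ (j - i) * gen_poly n.+1 b ^+ i))`_n.
Proof.
rewrite /rep -coefB subrXX gE [_ + _ - _]addrAC subrr add0r -gE.
rewrite mulr_sumr coef_sum; exact: eq_bigr.
Qed.

Let bc n i : (gen_poly n b)`_i <= (gen_poly n c)`_i.
Proof. by rewrite gE coefD lerDl gen_poly_ge0. Qed.

(** In each of the [j.+1] terms of [diff], [b] is replaced by the larger set [c]. *)
Lemma rep_split_le j n :
  rep c j.+1 n <=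
  rep b j.+1 n + j.+1%:R * \sum_(k < n.+1) (s k)%:R * rep c j (n - k).
Proof.
rewrite -lerBlDl diff -(@coef_gen_polyM n.+1) //.
rewrite [leRHS]mulr_natl -[X in _ *+ X]card_ord -sumr_const.
apply: ler_sum => i _; apply: (@coefM_le n) => // [k|k|k nk].
- exact: gen_poly_ge0.
- by apply: coefM_ge0 => m; apply: coefX_ge0 => ?; apply: gen_poly_ge0.
- have -> : gen_poly n.+1 c ^+ j = gen_poly n.+1 c ^+ (j - i) * gen_poly n.+1 c ^+ i.
    by rewrite -exprD subnK // -ltnS.
  apply: (@coefM_le n) => // m; rewrite ?coefX_ge0 // => *;
    try exact: gen_poly_ge0.
  by apply: (@coefX_le n) => // *; rewrite ?gen_poly_ge0 ?bc.
Qed.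

(** Of the nonnegative terms of [diff], only the one with [i = 0] is kept. *)
Lemma rep_split_ge j n :
  rep b j.+1 n + \sum_(k < n.+1) (s k)%:R * rep c j (n - k) <= rep c j.+1 n.
Proof.
rewrite -lerBrDl diff -(@coef_gen_polyM n.+1) // big_ord_recl.
rewrite subn0 expr0 mulr1 lerDl; apply: sumr_ge0 => i _.
apply: coefM_ge0 => m; first exact: gen_poly_ge0.
by apply: coefM_ge0 => ?; apply: coefX_ge0 => ?; apply: gen_poly_ge0.
Qed.

End Split.

Lemma cnt_ge0 b n : 0 <= cnt b n.
Proof. by rewrite sumr_ge0. Qed.

Lemma horner_gen_poly n b : (gen_poly n.+1 b).[1] = cnt b n.
Proof.
rewrite horner_poly; apply: eq_bigr => i _; by rewrite expr1n mulr1.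
Qed.

Lemma size_gen_polyX n b j : (size (gen_poly n.+1 b ^+ j)%R <= (j * n).+1)%N.
Proof.
rewrite (leq_trans (size_poly_exp_leq _ _)) // ltnS mulnC leq_mul2l.
by have := size_poly n.+1 (fun i => (b i)%:R : R); rewrite -/(gen_poly _ _); lia.
Qed.

(** Evaluation at 1 adds up all coefficients of the [j]-th power; those beyond [n] are nonnegative
    and dropped. *)
Lemma sum_rep_le b j n : \sum_(m < n.+1) rep b j m <= cnt b n ^+ j.
Proof.
rewrite -horner_gen_poly -horner_exp.
rewrite (@horner_coef_wide _ (n.+1 + (j * n).+1)); last first.
  by rewrite (leq_trans (size_gen_polyX _ _ _)) // leq_addl.
rewrite big_split_ord /= -[leLHS]addr0 lerD //; last first.
  by apply: sumr_ge0 => i _; rewrite expr1n mulr1 coefX_ge0 // => ?; apply: gen_poly_ge0.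
by apply: ler_sum => i _; rewrite expr1n mulr1 coefX_gen_poly.
Qed.

(** The [j]-th power of the polynomial cut at [n] has degree at most [m], so the sum up to [m]
    misses none of its coefficients. *)
Lemma sum_rep_ge b j n m : (j * n <= m)%N ->
  cnt b n ^+ j <= \sum_(i < m.+1) rep b j i.
Proof.
move=> jn; rewrite -horner_gen_poly -horner_exp.
rewrite (@horner_coef_wide _ m.+1); last first.
  by rewrite (leq_trans (size_gen_polyX _ _ _)).
apply: ler_sum => i _; rewrite expr1n mulr1; apply: (@coefX_le i) => // k.
  exact: gen_poly_ge0.
rewrite !coef_gen_poly => ki; case: ifP => // _; last by case: ifP.
by rewrite ltnS ki.
Qed.

End Representations.

(** * Insertion of elements in increasing order *)

Section Increments.
Variable R : realFieldType.
Implicit Types (b : nat -> bool).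
Local Notation rep := (@rep R).
Local Notation cnt := (@cnt R).

Definition below b k : nat -> bool := fun i => b i && (i < k)%N.

Definition topped b k : nat -> bool := fun i => below b k i || (i == k).

(** The value [b k] does not enter, so this number is known before it is decided whether [k] is
    taken. *)
Definition increment b j n k : R := rep (topped b k) j n - rep (below b k) j n.

Lemma topped_disj b k i : ~~ (below b k i && (i == k)).
Proof. by rewrite /below; case: eqP => [->|]; rewrite ?ltnn ?andbF. Qed.

Lemma sum_pick (F : nat -> R) n k :
  \sum_(i < n.+1) (val i == k)%:R * F i = if (k <= n)%N then F k else 0.
Proof.
case: leqP => kn.
  rewrite (bigD1 (inord k)) //= inordK // eqxx mul1r big1 ?addr0 // => i.
  move=> ik; case: eqP => [E|]; rewrite ?mul0r //.
  by case/eqP: ik; apply: val_inj; rewrite /= inordK.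
rewrite big1 // => i _; case: eqP => [E|]; rewrite ?mul0r //.
by have := ltn_ord i; rewrite E ltnS leqNgt kn.
Qed.

Lemma eq_increment b c j n k :
  (forall i, (i < k)%N -> b i = c i) -> increment b j n k = increment c j n k.
Proof.
move=> bc; rewrite /increment; congr (_ - _); apply: eq_rep => i _;
  rewrite /topped /below; case: ltnP => ik; by rewrite ?andbF ?(bc i ik).
Qed.

Lemma increment_le b j n k : (k <= n)%N ->
  increment b j.+1 n k <= j.+1%:R * rep (topped b k) j (n - k).
Proof.
move=> kn; rewrite lerBlDl.
have := rep_split_le R (fun i => erefl (topped b k i)) (topped_disj b k) j n.
by rewrite (sum_pick (fun i => rep (topped b k) j (n - i)))%N kn.
Qed.

Lemma increment_ge b j n k : (k <= n)%N ->
  rep (topped b k) j (n - k) <= increment b j.+1 n k.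
Proof.
move=> kn; rewrite lerBrDl.
have := rep_split_ge R (fun i => erefl (topped b k i)) (topped_disj b k) j n.
by rewrite (sum_pick (fun i => rep (topped b k) j (n - i)))%N kn.
Qed.

Lemma increment_ge0 b j n k : 0 <= increment b j n k.
Proof. by rewrite subr_ge0; apply: rep_mono => i _; rewrite /topped => ->. Qed.

Lemma increment_lt b j n k : (j * k < n)%N -> increment b j n k = 0.
Proof.
case: j => [|j] jk; first by rewrite /increment !rep0 subrr.
apply/le_anti/andP; split; last exact: increment_ge0.
rewrite (le_trans (increment_le _ _ _)) //; first by lia.
rewrite (@rep_gt_support _ _ _ k) ?mulr0 // => [i|]; last by lia.
by rewrite /topped /below => /orP[/andP[_ /ltnW]|/eqP->].
Qed.

Lemma increment_le_rep b j n k : (k <= n)%N -> b k ->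
  increment b j.+1 n k <= j.+1%:R * rep b j (n - k).
Proof.
move=> kn bk; rewrite (le_trans (increment_le _ _ kn)) // ler_wpM2l //.
apply: rep_mono => i _; rewrite /topped /below => /orP[/andP[]//|/eqP->//].
Qed.

(** Since [n - k < k], every representation of [n - k] uses only elements below [k]; appending [k]
    gives a new representation of [n]. *)
Lemma increment_ge_rep b j n k : (k <= n)%N -> (n - k < k)%N ->
  rep b j (n - k) <= increment b j.+1 n k.
Proof.
move=> kn nk; rewrite (le_trans _ (increment_ge _ _ kn)) //.
apply: rep_mono => i ni bi; rewrite /topped /below bi (leq_ltn_trans ni nk) //.
Qed.

(** Telescoping over the insertion of the elements of [b] in increasing order. *)
Lemma rep_increments b j n :
  rep b j.+1 n = \sum_(k < n.+1) (b k)%:R * increment b j.+1 n k.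
Proof.
transitivity (rep (below b n.+1) j.+1 n).
  by apply: eq_rep => i ni; rewrite /below ltnS ni andbT.
suff H m : rep (below b m) j.+1 n = \sum_(k < m) (b k)%:R * increment b j.+1 n k by [].
elim: m => [|m IH].
  rewrite big_ord0 repS big1 // => k _.
  by rewrite /below andbF mul0r.
rewrite big_ord_recr /= -IH.
case: (boolP (b m)) => bm; last first.
  rewrite mul0r addr0; apply: eq_rep => i _; rewrite /below ltnS leq_eqVlt.
  by case: eqP => [->|//]; rewrite (negbTE bm).
rewrite mul1r /increment addrC subrK; apply: eq_rep => i _.
rewrite /topped /below ltnS leq_eqVlt.
by case: eqP => [->|]; rewrite ?bm ?orbT ?orbF.
Qed.

Section SumTopped.
Variables (b : nat -> bool) (n : nat).
Let g j k x : R := if (x <= n)%N then rep (topped b k) j (n - x) else 0.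

Let gS j k x : (k <= n)%N ->
  g j.+1 k x <= \sum_(i < n.+1) (b i)%:R * g j k (x + i) + g j k (x + k).
Proof.
move=> kn; have g0 y : 0 <= g j k y by rewrite /g; case: ifP => // _; rewrite rep_ge0.
rewrite {1}/g; case: leqP => xn; last first.
  by rewrite addr_ge0 // sumr_ge0 // => i _; rewrite mulr_ge0.
have -> : g j k (x + k) = \sum_(i < n.+1) (val i == k)%:R * g j k (x + i).
  by rewrite (sum_pick (fun i => g j k (x + i)%N)) kn.
rewrite -big_split /= repS.
rewrite (big_ord_widen n.+1 (fun i => (topped b k i)%:R * rep (topped b k) j (n - x - i)));
  last by rewrite ltnS leq_subr.
rewrite big_mkcond /=; apply: ler_sum => i _; case: ifP => ix; last first.
  by rewrite addr_ge0 // mulr_ge0.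
rewrite -mulrDl.
have -> : g j k (x + i) = rep (topped b k) j (n - x - i).
  rewrite /g subnDA; case: leqP => //.
  by move: ix; rewrite ltnS; lia.
rewrite ler_wpM2r ?rep_ge0 // -natrD ler_nat /topped /below.
by case: (b i); case: (i < k)%N; case: eqP.
Qed.

(** Each of the [j] summands is an element of [b] up to [n] or the variable [k] itself, which makes
    [cnt b n + 1] choices; afterwards [c * k + e = n] leaves at most one [k]. In the induction [c]
    counts the copies of [k] and [e] collects the other summands. *)
Let sum_g j c e : (0 < c)%N ->
  \sum_(k < n.+1) g j k (c * k + e) <= (cnt b n + 1) ^+ j.
Proof.
elim: j c e => [|j IH] c e c0.
  rewrite expr0.
  case: (pickP (fun k : 'I_n.+1 => c * k + e == n)%N) => [k /eqP E|none].
    rewrite (bigD1 k) //= big1 ?addr0 => [|i ik].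
      by rewrite /g rep0 E leqnn subnn.
    rewrite /g rep0; case: ifP => // le; case: eqP => // E'.
    have : (c * i = c * k)%N by lia.
    by move/eqP; rewrite eqn_mul2l eqn0Ngt c0 /= => /eqP/val_inj E2; rewrite E2 eqxx in ik.
  rewrite big1 // => k _; rewrite /g rep0; case: ifP => // le; case: eqP => // E.
  by have := none k => /=; lia.
have A0 := cnt_ge0 R b n.
rewrite (@le_trans _ _ (\sum_(k < n.+1) (\sum_(i < n.+1) (b i)%:R * g j k (c * k + (e + i)) +
   g j k (c.+1 * k + e)))) //.
  apply: ler_sum => k _; apply: (le_trans (gS _ _ _)).
    by rewrite -ltnS.
  rewrite le_eqVlt; apply/orP; left; apply/eqP; congr (_ + _).
    by apply: eq_bigr => i _; rewrite addnA.
  by congr g; lia.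
rewrite big_split /= exprS mulrDl mul1r lerD ?IH // exchange_big /=.
rewrite {1}/(cnt b n) mulr_suml; apply: ler_sum => i _.
by rewrite -mulr_sumr ler_wpM2l // IH.
Qed.

Lemma sum_topped j :
  \sum_(k < n.+1) rep (topped b k) j (n - k) <= (cnt b n + 1) ^+ j.
Proof.
rewrite (le_trans _ (sum_g j 0 (ltn0Sn 0))) //; apply: ler_sum => k _.
by rewrite mul1n addn0 /g -ltnS ltn_ord.
Qed.

End SumTopped.

Lemma sum_increment b j n :
  \sum_(k < n.+1) increment b j.+1 n k <= j.+1%:R * (cnt b n + 1) ^+ j.
Proof.
apply: (@le_trans _ _ (j.+1%:R * \sum_(k < n.+1) rep (topped b k) j (n - k))).
  by rewrite mulr_sumr ler_sum // => k _; rewrite increment_le // -ltnS.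
by rewrite ler_wpM2l // sum_topped.
Qed.

End Increments.

(** * Greedy choice *)

Section Greedy.
Variables (R : realType) (p : nat -> R) (T : finType) (h : nat).
Variable U : nat -> T -> (nat -> bool) -> nat -> R.
Variable w : nat -> R.
Hypothesis p01 : forall k, 0 <= p k <= 1.
Hypothesis eqU : forall n t b c k,
  (forall i, (i < k)%N -> b i = c i) -> U n t b k = U n t c k.
Hypothesis U0 : forall n t b k, (h * k.+1 <= n)%N -> U n t b k = 0.
Hypothesis w0 : forall n, 0 <= w n.
Hypothesis sum_w : forall N, \sum_(n < N) #|T|%:R * w n <= 1.

Definition martingale n t (b : nat -> bool) k : R :=
  expR (\sum_(i < k) ((b i)%:R * U n t b i - p i * (expR (U n t b i) - 1))).

(** Finitely many [n] matter at stage [k]: by [U0], [martingale n t b k] is 1 as soon as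
    [h * k <= n]. *)
Let potential b k N := \sum_(n < N) \sum_t w n * martingale n t b k.

Let assign (b : nat -> bool) k v i := if i == k then v else b i.

Let eq_martingale n t b c k :
  (forall i, (i < k)%N -> b i = c i) -> martingale n t b k = martingale n t c k.
Proof.
move=> bc; congr expR; apply: eq_bigr => i _.
rewrite bc // (@eqU _ _ _ c) // => j ji; apply: bc.
exact: ltn_trans ji (ltn_ord i).
Qed.

Let martingale_ge0 n t b k : 0 <= martingale n t b k.
Proof. exact: expR_ge0. Qed.

Let martingaleS n t b k v : martingale n t (assign b k v) k.+1 =
  martingale n t b k * expR (v%:R * U n t b k - p k * (expR (U n t b k) - 1)).
Proof.
have E i : (i < k)%N -> assign b k v i = b i.
  by rewrite /assign; case: eqP => // ->; rewrite ltnn.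
rewrite {1}/martingale big_ord_recr /= expRD -/(martingale _ _ _ _).
by rewrite (eq_martingale _ _ E) (eqU _ _ E) /assign eqxx.
Qed.

(** With [x = p k * (expR u - 1)], the mean of the new factor before compensation is [1 + x], which
    is at most [expR x]. *)
Let martingale_avg n t b k :
  p k * martingale n t (assign b k true) k.+1 +
  (1 - p k) * martingale n t (assign b k false) k.+1 <= martingale n t b k.
Proof.
rewrite !martingaleS mul1r mul0r sub0r.
set M := martingale _ _ _ _; set u := U _ _ _ _.
have -> : p k * (M * expR (u - p k * (expR u - 1))) +
   (1 - p k) * (M * expR (- (p k * (expR u - 1)))) =
   M * ((1 + p k * (expR u - 1)) * expR (- (p k * (expR u - 1)))).
  by rewrite expRD; ring.
rewrite -[leRHS]mulr1 ler_wpM2l ?martingale_ge0 //.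
rewrite expRN ler_pdivrMr ?expR_gt0 // mul1r; exact: expR_ge1Dx.
Qed.

Let potential_avg b k N :
  p k * potential (assign b k true) k.+1 N +
  (1 - p k) * potential (assign b k false) k.+1 N <= potential b k N.
Proof.
rewrite /potential !mulr_sumr -big_split; apply: ler_sum => n _ /=.
rewrite !mulr_sumr -big_split; apply: ler_sum => t _ /=.
by rewrite !mulrA ![_ * w n]mulrC -!mulrA -mulrDr ler_wpM2l // martingale_avg.
Qed.

(** Leaving [k] out is preferred, which ensures that no [k] with [p k = 0] is taken. *)
Let choice b k : bool :=
  ~~ (potential (assign b k false) k.+1 (h * k.+1) <= potential b k (h * k.+1)).

(** If leaving [k] out raises the potential, taking it cannot, because the weighted mean of the two
    outcomes does not exceed the current value. *)
Let choiceP b k : (p k = 0 -> ~~ choice b k) /\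
  potential (assign b k (choice b k)) k.+1 (h * k.+1) <= potential b k (h * k.+1).
Proof.
have := potential_avg b k (h * k.+1); have /andP[p0 p1] := p01 k.
rewrite /choice; case: (leP (potential (assign b k false) _ _)) => /=.
  by move=> le _; split.
move=> lt av; have [pk0|pk0] := eqVneq (p k) 0.
  by move: av; rewrite pk0 mul0r subr0 mul1r add0r leNgt lt.
split=> [/eqP|]; first by rewrite (negbTE pk0).
rewrite -(@ler_pM2l _ (p k)) ?lt0r ?pk0 //.
move: av lt; set x := potential _ _ _; set y := potential _ _ _.
set z := potential _ _ _ => av lt.
suff : (1 - p k) * z <= (1 - p k) * y by lra.
by apply: ler_wpM2l; [lra|apply: ltW].
Qed.

Fixpoint history k : nat -> bool :=
  if k is k'.+1 then assign (history k') k' (choice (history k') k')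
  else fun=> false.

Let greedy i := history i.+1 i.

Let greedyE k i : (i < k)%N -> greedy i = history k i.
Proof.
elim: k => // k IH; rewrite ltnS leq_eqVlt => /orP[/eqP -> //|ik].
by rewrite IH //= /assign; case: eqP => // E; rewrite E ltnn in ik.
Qed.

(** The step to [k.+1] brings in the [n] from [h * k] up to [h * k.+1]. Their martingales still
    equal 1 at stage [k], so each adds exactly [#|T|%:R * w n]. *)
Let potential_greedy k :
  potential greedy k (h * k) <= \sum_(n < (h * k)%N) #|T|%:R * w n.
Proof.
have martingale1 n t b k' : (h * k' <= n)%N -> martingale n t b k' = 1.
  move=> hn; rewrite /martingale big1 ?expR0 // => i _.
  rewrite U0 ?expR0 ?subrr ?mulr0 ?subrr // (leq_trans _ hn) //.
  by rewrite leq_mul2l ltn_ord orbT.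
elim: k => [|k IH]; first by rewrite muln0 /potential !big_ord0.
have -> : potential greedy k.+1 (h * k.+1) =
    potential (history k.+1) k.+1 (h * k.+1).
  apply: eq_bigr => n _; apply: eq_bigr => t _; congr (_ * _).
  by apply: eq_martingale => i ik; apply: greedyE.
rewrite (le_trans (choiceP _ _).2) //.
have -> : potential (history k) k (h * k.+1) = potential greedy k (h * k.+1).
  apply: eq_bigr => n _; apply: eq_bigr => t _; congr (_ * _).
  by apply: eq_martingale => i ik; rewrite (@greedyE k).
move: IH; rewrite /potential.
rewrite -!(big_mkord xpredT (fun n => \sum_t w n * martingale n t greedy k)).
rewrite -!(big_mkord xpredT (fun n => #|T|%:R * w n)) => IH.
rewrite ![\sum_(0 <= i < h * k.+1) _](@big_cat_nat _ _ _ (h * k)) ?leq_mul2l ?leqnSn ?orbT //=.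
apply: lerD => //; rewrite big_nat [leRHS]big_nat; apply: ler_sum => n /andP[hn _].
by under eq_bigr do rewrite martingale1 // mulr1; rewrite sumr_const mulr_natl.
Qed.

Lemma greedy_selection : exists a : nat -> bool,
  (forall k, p k = 0 -> ~~ a k) /\
  forall n t k, w n * martingale n t a k <= 1.
Proof.
exists greedy; split=> [k pk0|n t k].
  by rewrite /greedy /= /assign eqxx; have [/(_ pk0)] := choiceP (history k) k.
have [nk|nk] := ltnP n (h * k).
  (* A single nonnegative term is bounded by the whole potential. *)
  rewrite (le_trans _ (sum_w (h * k))) // (le_trans _ (potential_greedy k)) //.
  rewrite /potential (bigD1 (Ordinal nk)) //= (bigD1 t) //= -addrA lerDl.
  rewrite addr_ge0 // sumr_ge0 // => *; first by rewrite mulr_ge0.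
  by rewrite sumr_ge0 // => *; rewrite mulr_ge0.
have -> : martingale n t greedy k = 1.
  rewrite /martingale big1 ?expR0 // => i _.
  rewrite U0 ?expR0 ?subrr ?mulr0 ?subrr // (leq_trans _ nk) //.
  by rewrite leq_mul2l ltn_ord orbT.
rewrite mulr1 (le_trans _ (sum_w n.+1)) // big_ord_recr /=.
rewrite -[leLHS]add0r lerD ?sumr_ge0 // => [i _|]; first by rewrite mulr_ge0.
rewrite ler_peMl // ler1n; apply/card_gt0P; by exists t.
Qed.

End Greedy.

(** * Sets with prescribed representation function *)

Section ExpBounds.
Variable R : realType.
Implicit Types u : R.

(** Multiply [1 - u <= expR (- u)] by [expR u]. *)
Lemma expR_sub1_le u : expR u - 1 <= u * expR u.
Proof.
have e0 := expR_gt0 u; have := expR_ge1Dx (- u).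
rewrite expRN -(ler_pM2r e0) mulVf ?gt_eqF //; lra.
Qed.

Lemma expR1_le4 : expR 1 <= 4 :> R.
Proof.
have h0 := expR_gt0 (2^-1 : R).
have h2 : expR (2^-1 : R) <= 2.
  by have := expR_sub1_le (2^-1); lra.
have -> : 1 = 2^-1 + 2^-1 :> R by lra.
rewrite expRD; nra.
Qed.

Lemma expR_sub1_le4 u : 0 <= u <= 1 -> expR u - 1 <= 4 * u.
Proof.
move=> /andP[u0 u1]; rewrite (le_trans (expR_sub1_le u)) // [leRHS]mulrC.
by rewrite ler_wpM2l // (le_trans _ expR1_le4) // ler_expR.
Qed.

Lemma expRN_sub1_le4 u : 0 <= u <= 1 -> expR (- u) - 1 <= - (u / 4).
Proof.
move=> /andP[u0 u1]; have e0 := expR_gt0 (- u).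
have e1 : 4^-1 <= expR (- u).
  rewrite expRN lef_pV2 ?posrE ?expR_gt0 //.
  by rewrite (le_trans _ expR1_le4) // ler_expR.
have := expR_sub1_le (- u); nra.
Qed.

End ExpBounds.

Lemma sum_gt (R : realType) m n :
  \sum_(k < n.+1) (m < val k)%N%:R = (n - m)%N%:R :> R.
Proof.
elim: n => [|n IH]; first by rewrite big_ord1 /=.
rewrite big_ord_recr IH /= -natrD; congr (_%:R); lia.
Qed.

(** * Tail bounds for the selected set *)

Section Core.
Variables (R : realType) (h1 : nat) (G : nat -> R) (D g d : R) (m0 : nat).
Hypothesis h1_gt0 : (0 < h1)%N.
Let h := h1.+1.
Hypothesis D1 : 1 <= D.
Hypothesis g0 : 0 < g.
Hypothesis d01 : 0 < d <= 1.

(** Solution of [c = c / (1 + g) + 5]: halving the argument divides [G] by at least [1 + g], and the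
    upper half of [[0, n]] receives at most [5 * G n] elements. *)
Definition cnt_const : R := 5 * (1 + g) / g.

(* It bounds [rep a j.+1] for [j < h1]. Since it does not involve [G], the
   lower bound on [G] in [G_dense] below can be chosen after it. *)
Fixpoint level_bound j : R :=
  if j is j'.+1 then 3 * j'.+2%:R * level_bound j' / d else 1.

(** By [increment_le_rep], a bound for the increments of [rep a h] at chosen elements. *)
Definition main_bound : R := h%:R * level_bound h1.-1.

(** The constant of [main_mean]: [D^-1] comes from [p_ge], and each of the [h1] other factors
    combines [cnt_lower] with the comparison of [G n] and [G (n %/ (2 * h))]. *)
Definition main_const : R := D^-1 * (16 * D * D ^+ (4 * h)) ^- h1.

Hypothesis m0_gt : (2 * h + 5 < m0)%N.
Hypothesis G1 : forall n, (m0 <= n)%N -> 1 <= G n.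
Hypothesis Gn : forall n, (m0 <= n)%N -> G n <= n%:R.
Hypothesis G_mono : forall m n, (m0 <= m)%N -> (m <= n)%N -> G m <= G n.
Hypothesis G_double : forall n, (m0 <= n)%N -> G (2 * n)%N <= D * G n.
Hypothesis G_grow : forall n, (m0 <= n)%N -> (1 + g) * G n <= G (2 * n)%N.
Hypothesis ln1 : forall n, (m0 <= n)%N -> 1 <= ln (n%:R : R).
Hypothesis G_ln : forall n, (m0 <= n)%N -> 32 * D * ln (n%:R : R) <= G n.
Hypothesis G_sparse : (1 < h1)%N -> forall n, (m0 <= n)%N ->
  (h%:R ^+ 2 * (cnt_const + 1) ^+ h) * G n ^+ h1 * expR (d * ln n%:R) <= n%:R.
Hypothesis G_dense : forall n, (m0 <= n)%N ->
  16 * main_bound / main_const * (n%:R * ln (n%:R : R)) <= G n ^+ h.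

Let p k : R := if (m0 <= k)%N then G k / k%:R else 0.

(** Normalised so that [slope j] times the truncated increment is at most [d], which keeps the
    exponent in [U] below [d * ln n]. *)
Let slope j : R := d / (j.+2%:R * level_bound j).

(** The tests: elements in the upper half of [[0, n]] and representations with [h] summands, both
    with two signs, then upper tails for [j.+2] summands. *)
Let T : finType := (bool + (bool + 'I_h1))%type.

Let sg (s : bool) : R := if s then 1 else -1.

(** The truncations bound the exponents in advance; at chosen elements they become inactive once
    fewer summands are under control. *)
Let U n (t : T) (b : nat -> bool) k : R :=
  match t with
  | inl s => sg s * (n./2 < k <= n)%N%:R
  | inr (inl s) => sg s * (Num.min (increment R b h n k) main_bound / main_bound)
  | inr (inr j) => slope j * ln n%:R *
      Num.min (increment R b j.+2 n k) (j.+2%:R * level_bound j)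
  end.

Let w n : R := if (m0 <= n)%N then n%:R ^- 2 else 0.

Let cnt_const_gt0 : 0 < cnt_const.
Proof. by rewrite divr_gt0 // mulr_gt0 // addr_gt0. Qed.

Let G_ge0 n : (m0 <= n)%N -> 0 <= G n.
Proof. by move=> /G1; apply: le_trans. Qed.

Let p01 k : 0 <= p k <= 1.
Proof.
rewrite /p; case: ifP => [mk|]; last by rewrite lexx ler01.
have k0 : 0 < k%:R :> R by rewrite ltr0n; natlia.
rewrite divr_ge0 ?G_ge0 //= ler_pdivrMr // mul1r; exact: Gn.
Qed.

Let level_bound_ge1 j : 1 <= level_bound j.
Proof.
have /andP[d0 d1] := d01.
elim: j => //= j IH; rewrite ler_pdivlMr // mul1r.
rewrite (le_trans d1) // -mulrA mulr_ege1 ?ler1n // mulr_ege1 ?ler1n //.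
Qed.

Let level_bound_gt0 j : 0 < level_bound j.
Proof. exact: lt_le_trans ltr01 (level_bound_ge1 j). Qed.

Let main_bound_gt0 : 0 < main_bound.
Proof. by rewrite /main_bound mulr_gt0. Qed.

Let w0 n : 0 <= w n.
Proof. by rewrite /w; case: ifP => // _; rewrite invr_ge0 exprn_ge0. Qed.

Let sum_w N : \sum_(n < N) #|T|%:R * w n <= 1.
Proof.
have cT : #|T| = h1.+4 by rewrite !card_sum card_bool card_ord; natlia.
rewrite -mulr_sumr cT.
have m1 : 0 < m0.-1%:R :> R by rewrite ltr0n; natlia.
suff : \sum_(n < N) w n <= m0.-1%:R^-1.
  move=> le; apply: (@le_trans _ _ (m0.-1%:R * m0.-1%:R^-1)).
    apply: ler_pM => //; first by rewrite sumr_ge0.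
    by rewrite ler_nat; natlia.
  by rewrite mulfV ?gt_eqF.
have le0 : forall n, (n <= m0)%N -> \sum_(i < n) w i = 0.
  by move=> n nm; rewrite big1 // => i _; rewrite /w leqNgt (leq_trans (ltn_ord i)).
case: (leqP N m0) => Nm; first by rewrite le0 // invr_ge0 ltW.
rewrite -(subnKC (ltnW Nm)); elim: (N - m0)%N => [|i IH].
  by rewrite addn0 le0 // invr_ge0 ltW.
(* Telescoping: [n ^- 2] is at most [(n - 1)^-1 - n^-1]. *)
suff H k : \sum_(i < m0 + k) w i <= m0.-1%:R^-1 - (m0 + k).-1%:R^-1.
  by rewrite (le_trans (H _)) // gerBl invr_ge0.
elim: k => [|k IHk]; first by rewrite addn0 le0 // subrr.
rewrite addnS big_ord_recr /= /w leq_addr (le_trans (lerD IHk (lexx _))) //.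
have [e ->] : exists e, (m0 + k = e.+2)%N by exists (m0 + k).-2; natlia.
rewrite /= -addrA lerD2l -subr_ge0.
have e0 : 0 < e.+1%:R :> R by rewrite ltr0n.
rewrite -[e.+2]addn1 natrD; set x : R := e.+1%:R in e0 *.
have -> : - (x + 1)^-1 - (- x^-1 + (x + 1) ^- 2) = (x * (x + 1) ^+ 2)^-1.
  by field; rewrite gt_eqF //= gt_eqF //; lra.
by rewrite invr_ge0; nra.
Qed.

Let eqU n t b c k :
  (forall i, (i < k)%N -> b i = c i) -> U n t b k = U n t c k.
Proof. by case: t => [//|[s|j]] bc; rewrite /= (eq_increment _ _ _ bc). Qed.

Let U0 n t b k : (h * k.+1 <= n)%N -> U n t b k = 0.
Proof.
case: t => [s|[s|j]] hk /=.
- suff -> : (n./2 < k <= n)%N = false by rewrite mulr0.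
  by apply/negP => /andP[nk _]; rewrite /h in hk; nia.
- rewrite increment_lt; last by rewrite /h in hk *; nia.
  by rewrite minEle (ltW main_bound_gt0) mul0r mulr0.
- rewrite increment_lt; last by rewrite /h in hk; have := ltn_ord j; nia.
  by rewrite minEle mulr_ge0 ?mulr0 // ltW.
Qed.

Section Selected.
Variable a : nat -> bool.
Hypothesis a0 : forall k, p k = 0 -> ~~ a k.
Hypothesis selected : forall n t k, w n * martingale p U n t a k <= 1.

Let am0 k : a k -> (m0 <= k)%N.
Proof.
by case: (leqP m0 k) => // mk; rewrite (negbTE (a0 _)) // /p leqNgt mk.
Qed.

(** Logarithm of [selected]; the weight [n ^- 2] costs the error [2 * ln n]. *)
Let deviation n t k : (m0 <= n)%N ->
  \sum_(i < k) (a i)%:R * U n t a i <=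
  \sum_(i < k) p i * (expR (U n t a i) - 1) + 2 * ln n%:R.
Proof.
move=> mn; have n0 : 0 < n%:R :> R by rewrite ltr0n; natlia.
have := selected n t k; rewrite /w mn /martingale sumrB.
rewrite mulrC ler_pdivrMr ?exprn_gt0 // mul1r -ler_ln ?posrE ?exprn_gt0 ?expR_gt0 //.
by rewrite expRK lnXn // mulr_natl lerBlDl.
Qed.

Let cnt_half n :
  cnt R a n = cnt R a n./2 + \sum_(k < n.+1) (a k)%:R * (n./2 < k <= n)%N%:R.
Proof.
have -> : cnt R a n./2 = \sum_(k < n.+1) (if (k < n./2.+1)%N then (a k)%:R else 0).
  by rewrite /cnt (big_ord_widen n.+1 (fun k => (a k)%:R : R)) ?big_mkcond //; natlia.
rewrite -big_split; apply: eq_bigr => k _ /=.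
by rewrite ltnS -[(k <= n)%N]ltnS ltn_ord andbT; case: leqP; rewrite ?mulr0 ?addr0 ?mulr1 ?add0r.
Qed.

Let window_le n : (m0 <= n)%N ->
  \sum_(k < n.+1) p k * (n./2 < k <= n)%N%:R <= G n.
Proof.
move=> mn.
apply: (@le_trans _ _ (\sum_(k < n.+1) (G n / (n.+1%:R / 2)) * (n./2 < k)%N%:R)).
  apply: ler_sum => k _; rewrite -[(k <= n)%N]ltnS ltn_ord andbT.
  case: ltnP => nk; rewrite ?mulr0 // !mulr1 /p.
  case: ifP => mk; last by rewrite divr_ge0 ?G_ge0 ?divr_ge0.
  have kn : (k <= n)%N by rewrite -ltnS.
  apply: ler_pM; rewrite ?G_ge0 ?invr_ge0 ?G_mono //.
  rewrite lef_pV2 ?posrE ?divr_gt0 ?ltr0n //; last by natlia.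
  by rewrite ler_pdivrMr // -natrM ler_nat; natlia.
rewrite -mulr_sumr sum_gt -mulrA ler_piMr ?G_ge0 //.
rewrite mulrC ler_pdivrMr ?divr_gt0 // mul1r ler_pdivlMr // -natrM ler_nat.
natlia.
Qed.

(** Monotonicity and doubling give [G n <= G (2 * k) <= D * G k]. *)
Let p_ge n k : (m0 <= k)%N -> (k <= n)%N -> (n <= 2 * k)%N ->
  G n / (D * n%:R) <= p k.
Proof.
move=> mk kn nk; have D0 := lt_le_trans ltr01 D1.
have k0 : 0 < k%:R :> R by rewrite ltr0n; natlia.
have n0 : 0 < n%:R :> R by rewrite ltr0n; natlia.
have mn : (m0 <= n)%N by natlia.
rewrite /p mk invfM mulrA; apply: ler_pM.
- by rewrite divr_ge0 ?G_ge0 // ltW.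
- by rewrite invr_ge0 ltW.
- by rewrite ler_pdivrMr // mulrC (le_trans (G_mono mn nk)) // G_double.
- by rewrite lef_pV2 ?posrE // ler_nat.
Qed.

Let window_ge n : (m0 <= n./2)%N ->
  G n / (2 * D) <= \sum_(k < n.+1) p k * (n./2 < k <= n)%N%:R.
Proof.
move=> mn; have D0 := lt_le_trans ltr01 D1.
have n0 : 0 < n%:R :> R by rewrite ltr0n; natlia.
apply: (@le_trans _ _ (\sum_(k < n.+1) (G n / (D * n%:R)) * (n./2 < k)%N%:R)).
  have -> : G n / (2 * D) = G n / (D * n%:R) * (n%:R / 2).
    by field; rewrite !gt_eqF.
  rewrite -mulr_sumr sum_gt ler_wpM2l //.
    by rewrite divr_ge0 ?G_ge0 ?mulr_ge0 ?ltW //; natlia.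
  by rewrite ler_pdivrMr // -natrM ler_nat; natlia.
apply: ler_sum => k _; rewrite -[(k <= n)%N]ltnS ltn_ord andbT.
case: ltnP => nk; rewrite ?mulr0 // !mulr1 p_ge //; [natlia| |natlia].
by rewrite -ltnS.
Qed.

Let ln_le n : (m0 <= n)%N -> 2 * ln (n%:R : R) <= G n.
Proof.
by move=> mn; have := ln1 mn; have := G_ln mn; have := D1; nra.
Qed.

(** Induction on halves: the upper half holds at most [4 * G n + 2 * ln n] elements, hence at most
    [5 * G n]. *)
Lemma cnt_upper n : (m0 <= n)%N -> cnt R a n <= cnt_const * G n.
Proof.
elim/ltn_ind: n => n IH mn.
have := @deviation n (inl true) n.+1 mn.
rewrite /= /sg; under eq_bigr do rewrite mul1r.
under [X in _ <= X + _]eq_bigr do rewrite mul1r.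
move=> dev; rewrite cnt_half.
have le4 : \sum_(i < n.+1) p i * (expR ((n./2 < i <= n)%N%:R) - 1) <= 4 * G n.
  rewrite (le_trans _ (ler_wpM2l _ (window_le mn))) // mulr_sumr; apply: ler_sum => i _.
  rewrite mulrCA ler_wpM2l //; first by case/andP: (p01 i).
  by apply: expR_sub1_le4; rewrite ler0n lern1 leq_b1.
have half : cnt R a n./2 <= cnt_const / (1 + g) * G n.
  case: (leqP m0 n./2) => mh.
    rewrite (le_trans (IH _ _ mh)) //; first natlia.
    rewrite -mulrA ler_wpM2l ?(ltW cnt_const_gt0) //.
    rewrite ler_pdivlMl ?addr_gt0 //.
    rewrite (le_trans (G_grow mh)) // G_mono //; natlia.
  rewrite /cnt big1; first by rewrite mulr_ge0 ?G_ge0 // divr_ge0 // ltW // addr_gt0.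
  move=> k _; case: (boolP (a k)) => // /am0.
  by have := ltn_ord k; natlia.
have := ln_le mn.
have -> : cnt_const * G n = cnt_const / (1 + g) * G n + 5 * G n.
  by rewrite /cnt_const; field; rewrite !gt_eqF ?addr_gt0.
lra.
Qed.

(** The upper half of [[0, n]] suffices. Its mean is at least [G n / (2 * D)], of which
    [expRN_sub1_le4] keeps a quarter; half of that quarter absorbs [2 * ln n]. *)
Lemma cnt_lower n : (m0 <= n./2)%N -> G n / (16 * D) <= cnt R a n.
Proof.
move=> mh; have mn : (m0 <= n)%N by natlia.
have D0 := lt_le_trans ltr01 D1.
have := @deviation n (inl false) n.+1 mn.
rewrite /= /sg; under eq_bigr do rewrite mulN1r mulrN.
under [X in _ <= X + _]eq_bigr do rewrite mulN1r.
rewrite sumrN => dev.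
have le4 : \sum_(i < n.+1) p i * (expR (- (n./2 < i <= n)%N%:R) - 1) <= - (G n / (2 * D) / 4).
  rewrite (@le_trans _ _ (\sum_(i < n.+1) - (p i * (n./2 < i <= n)%N%:R / 4))) //.
    apply: ler_sum => i _; rewrite -mulrA -mulrN ler_wpM2l //; first by case/andP: (p01 i).
    by apply: expRN_sub1_le4; rewrite ler0n lern1 leq_b1.
  by rewrite sumrN lerN2 -mulr_suml ler_wpM2r // window_ge.
rewrite cnt_half; have := cnt_ge0 R a n./2.
have : 2 * ln n%:R <= G n / (16 * D).
  by rewrite ler_pdivlMr ?mulr_gt0 //; have := G_ln mn; lra.
have E4 : G n / (2 * D) / 4 = G n / (16 * D) + G n / (16 * D).
  by field; rewrite gt_eqF.
move: dev le4; rewrite E4; lra.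
Qed.

(** Increments vanish when [j.+1 * k < n]; for the other [k], [p k] is at most [j.+1 * G n / n], and
    [sum_increment] applies. *)
Lemma sum_p_increment j n : (m0 <= n)%N ->
  \sum_(k < n.+1) p k * increment R a j.+1 n k <=
  j.+1%:R ^+ 2 * (cnt_const + 1) ^+ j * G n ^+ j.+1 / n%:R.
Proof.
move=> mn; have n0 : 0 < n%:R :> R by rewrite ltr0n; natlia.
apply: (@le_trans _ _ (\sum_(k < n.+1) (j.+1%:R * G n / n%:R) * increment R a j.+1 n k)).
  apply: ler_sum => k _; case: (ltnP (j.+1 * k) n) => jk.
    by rewrite increment_lt ?mulr0.
  rewrite ler_wpM2r ?increment_ge0 // /p; case: ifP => mk; last first.
    by rewrite !mulr_ge0 ?invr_ge0 ?G_ge0.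
  have k0 : 0 < k%:R :> R by rewrite ltr0n; natlia.
  rewrite mulrAC mulrC ler_pM ?G_ge0 ?invr_ge0 ?G_mono //; last by rewrite -ltnS.
  by rewrite ler_pdivlMr // ler_pdivrMl // -natrM ler_nat mulnC.
rewrite -mulr_sumr.
rewrite (le_trans (ler_wpM2l _ (sum_increment R a j n))) //.
  by rewrite !mulr_ge0 ?invr_ge0 ?G_ge0.
have le : (cnt R a n + 1) ^+ j <= ((cnt_const + 1) * G n) ^+ j.
  apply: lerXn2r; rewrite ?nnegrE ?addr_ge0 ?cnt_ge0 //.
    by rewrite mulr_ge0 ?G_ge0 // addr_ge0 // ltW.
  by rewrite mulrDl mul1r lerD ?cnt_upper ?G1.
apply: (@le_trans _ _ (j.+1%:R * G n / n%:R * (j.+1%:R * ((cnt_const + 1) * G n) ^+ j))).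
  apply: ler_wpM2l; first by rewrite !mulr_ge0 ?invr_ge0 ?G_ge0.
  by apply: ler_wpM2l.
rewrite le_eqVlt exprMn [G n ^+ _.+1]exprS; apply/orP; left; apply/eqP.
by field; rewrite gt_eqF.
Qed.

Let slope_gt0 j : 0 < slope j.
Proof. by case/andP: d01 => dp _; rewrite divr_gt0 // mulr_gt0. Qed.

Let slope_le1 j : slope j <= 1.
Proof.
case/andP: d01 => dp d1; rewrite ler_pdivrMr ?mulr_gt0 // mul1r.
by rewrite (le_trans d1) // mulr_ege1 ?ler1n.
Qed.

(** As [j.+2 <= h1], the expected increments add up to at most a constant times [G n ^+ h1 / n],
    which [G_sparse] makes at most [expR (- (d * ln n))]. *)
Let level_compensator j n : (j.+1 < h1)%N -> (m0 <= n)%N ->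
  ln n%:R * expR (d * ln n%:R) * (\sum_(k < n.+1) p k * increment R a j.+2 n k)
  <= ln n%:R.
Proof.
move=> jh mn; have n0 : 0 < n%:R :> R by rewrite ltr0n; natlia.
have l0 : 0 < ln (n%:R : R) by apply: lt_le_trans ltr01 (ln1 mn).
rewrite -mulrA ler_piMr ?(ltW l0) //.
rewrite (le_trans (ler_wpM2l (expR_ge0 _) (sum_p_increment _ mn))) //.
rewrite mulrA ler_pdivrMr // mul1r.
have h1' : (1 < h1)%N by natlia.
rewrite (le_trans _ (G_sparse h1' mn)) // mulrC ler_wpM2r ?expR_ge0 //.
have C1 : 1 <= cnt_const + 1 by rewrite lerDr ltW.
have C0 := le_trans ler01 C1.
have X0 c i : 0 <= c -> 0 <= c ^+ i :> R by move=> *; rewrite exprn_ge0.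
apply: ler_pM; [by rewrite mulr_ge0 ?X0|by rewrite X0 ?G_ge0| |by rewrite ler_weXn2l ?G1].
apply: ler_pM; rewrite ?exprn_ge0 //; last by rewrite ler_weXn2l // /h; natlia.
by rewrite lerXn2r ?nnegrE // ler_nat /h; natlia.
Qed.

(** By induction the truncation is inactive at chosen elements, so the test sum is
    [slope j * ln n * rep a j.+2 n]. The compensator is at most [ln n] and the error is [2 * ln n],
    whence the bound [3 / slope j], which is [level_bound j.+1]. *)
Lemma rep_level j n : (j < h1)%N -> rep R a j.+1 n <= level_bound j.
Proof.
elim: j n => [|j IH] n jh; first by rewrite rep1 /= lern1 leq_b1.
have [mn|mn] := leqP m0 n; last first.
  rewrite (rep_lt_support _ am0); last by rewrite (leq_trans mn) // leq_pmull.
  exact: ltW (level_bound_gt0 j.+1).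
have n0 : 0 < n%:R :> R by rewrite ltr0n; natlia.
have l0 : 0 < ln (n%:R : R) by apply: lt_le_trans ltr01 (ln1 mn).
have s0 := slope_gt0 j; have s1 := slope_le1 j.
have lj0 := level_bound_gt0 j.
have := @deviation n (inr (inr (Ordinal (ltnW jh)))) n.+1 mn; rewrite /=.
have -> : \sum_(i < n.+1) (a i)%:R * (slope j * ln n%:R *
     Num.min (increment R a j.+2 n i) (j.+2%:R * level_bound j)) =
     slope j * ln n%:R * rep R a j.+2 n.
  rewrite rep_increments mulr_sumr; apply: eq_bigr => i _; rewrite mulrCA.
  case: (boolP (a i)) => ai; rewrite ?mul0r // !mul1r; congr (_ * _).
  apply/min_idPl; rewrite (le_trans (increment_le_rep _ _ _ ai)) //; first by rewrite -ltnS.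
  by rewrite ler_wpM2l // IH // ltnW.
set S := \sum_(i < _) _ => dev.
have S_le : S <= ln n%:R.
  rewrite (le_trans _ (level_compensator jh mn)) // /S mulr_sumr.
  apply: ler_sum => i _; case/andP: (p01 i) => p0 _.
  rewrite [leRHS]mulrCA ler_wpM2l // (le_trans (expR_sub1_le _)) //.
  have inc0 := increment_ge0 R a j.+2 n i.
  set m := Num.min _ _.
  have m_ge0 : 0 <= m by rewrite /m le_min inc0 mulr_ge0 // ltW.
  rewrite [leRHS]mulrAC; apply: ler_pM; rewrite ?expR_ge0 //.
  - by rewrite mulr_ge0 // mulr_ge0 // ltW.
  - rewrite mulrAC [leRHS]mulrC ler_wpM2r ?(ltW l0) // (@le_trans _ _ (1 * m)) ?ler_wpM2r //.
    by rewrite mul1r /m ge_min lexx.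
  - rewrite ler_expR mulrAC ler_wpM2r ?(ltW l0) //.
    rewrite (@le_trans _ _ (slope j * (j.+2%:R * level_bound j))) //.
      by rewrite ler_wpM2l ?(ltW s0) // /m ge_min lexx orbT.
    by rewrite /slope mulfVK // gt_eqF // mulr_gt0.
have : slope j * ln n%:R * rep R a j.+2 n <= 3 * ln n%:R by lra.
rewrite mulrAC ler_pM2r // -ler_pdivlMl // => le; rewrite (le_trans le) //.
by rewrite /slope invf_div mulrC !mulrA.
Qed.

Let rep_level_max n : rep R a h1 n <= level_bound h1.-1.
Proof. by rewrite -{1}(prednK h1_gt0) rep_level // prednK. Qed.

Let sum_main n : (m0 <= n)%N ->
  \sum_(i < n.+1) (a i)%:R * (Num.min (increment R a h n i) main_bound / main_bound) =
  rep R a h n / main_bound.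
Proof.
move=> mn; rewrite rep_increments mulr_suml; apply: eq_bigr => i _.
rewrite -mulrA; case: (boolP (a i)) => ai; rewrite ?mul0r // !mul1r.
congr (_ / _); apply/min_idPl.
rewrite (le_trans (increment_le_rep _ _ _ ai)) //; first by rewrite -ltnS.
by rewrite /main_bound ler_wpM2l.
Qed.

Let main_const_gt0 : 0 < main_const.
Proof.
have D0 := lt_le_trans ltr01 D1.
by rewrite /main_const mulr_gt0 ?invr_gt0 ?exprn_gt0 ?mulr_gt0 ?exprn_gt0.
Qed.

Let ln_main n : (m0 <= n)%N ->
  main_bound * ln n%:R <= main_const / 16 * (G n ^+ h / n%:R).
Proof.
move=> mn; have n0 : 0 < n%:R :> R by rewrite ltr0n; natlia.
rewrite mulrA ler_pdivlMr //.
have := ler_wpM2l (ltW (divr_gt0 main_const_gt0 (ltr0n R 16))) (G_dense mn).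
rewrite mulrA => /(le_trans _); apply.
rewrite le_eqVlt; apply/orP; left; apply/eqP.
by field; rewrite gt_eqF.
Qed.

Lemma rep_upper n : (m0 <= n)%N ->
  rep R a h n <=
  (4 * h%:R ^+ 2 * (cnt_const + 1) ^+ h1 + main_const / 8) * (G n ^+ h / n%:R).
Proof.
move=> mn; have := @deviation n (inr (inl true)) n.+1 mn; rewrite /= /sg.
under eq_bigr do rewrite mul1r; rewrite sum_main //.
set S := \sum_(i < _) _ => dev.
have S_le : S <= 4 * h%:R ^+ 2 * (cnt_const + 1) ^+ h1 * (G n ^+ h / n%:R) / main_bound.
  have -> : 4 * h%:R ^+ 2 * (cnt_const + 1) ^+ h1 * (G n ^+ h / n%:R) / main_bound =
     4 / main_bound * (h%:R ^+ 2 * (cnt_const + 1) ^+ h1 * G n ^+ h / n%:R) by ring.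
  have c0 : 0 <= 4 / main_bound by rewrite divr_ge0 // ltW.
  rewrite (le_trans _ (ler_wpM2l c0 (sum_p_increment _ mn))) // mulr_sumr.
  apply: ler_sum => i _; rewrite mul1r; case/andP: (p01 i) => p0 _.
  rewrite [leRHS]mulrCA ler_wpM2l //.
  have inc0 := increment_ge0 R a h n i.
  rewrite (le_trans (expR_sub1_le4 _)) //.
    rewrite divr_ge0 ?le_min ?inc0 ?(ltW main_bound_gt0) //=.
    by rewrite ler_pdivrMr // mul1r ge_min lexx orbT.
  rewrite mulrAC -mulrA ler_wpM2l // ler_wpM2r ?invr_ge0 ?(ltW main_bound_gt0) //.
  by rewrite ge_min lexx.
have K0 : main_bound != 0 by rewrite gt_eqF.
rewrite -(ler_pM2r (_ : 0 < main_bound^-1)) ?invr_gt0 //.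
rewrite (le_trans dev) // (le_trans (lerD S_le (lexx _))) //.
set A := 4 * _ * _; rewrite [(A + _) * _]mulrDl [(A * _ + _) / _]mulrDl lerD2l ler_pdivlMr //.
have := ln_main mn; set q := (G n ^+ h / _); lra.
Qed.

Let G_iter s x n : (m0 <= x)%N -> (x <= n)%N -> (n <= 2 ^ s * x)%N ->
  G n <= D ^+ s * G x.
Proof.
move=> mx; elim: s n => [|s IH] n xn.
  by rewrite mul1n expr0 mul1r => nx; rewrite (_ : n = x) //; apply/eqP; rewrite eqn_leq nx.
move=> le; have D0 := lt_le_trans ltr01 D1.
have [xu|xu] := leqP x (uphalf n).
  rewrite (@le_trans _ _ (G (2 * uphalf n)%N)) //.
    by rewrite G_mono //; natlia.
  rewrite (le_trans (G_double _)) //; first by natlia.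
  rewrite exprS -mulrA ler_pM2l // IH //.
  by rewrite expnS in le; natlia.
rewrite (@le_trans _ _ (G (2 * x)%N)) //; first by rewrite G_mono //; natlia.
rewrite (le_trans (G_double _)) // exprS ler_wpM2r ?G_ge0 //.
by rewrite ler_peMr ?(ltW D0) // exprn_ege1.
Qed.

(** Only [k = n - m] with [m <= h1 * x] are kept. Then [m < k], so the increment is at least
    [rep a h1 m], which stays below the truncation; by [sum_rep_ge] these numbers add up to at least
    [cnt a x ^+ h1]. *)
Let main_mean n : (m0 <= (n %/ (2 * h))./2)%N ->
  main_const * (G n ^+ h / n%:R) <=
  \sum_(k < n.+1) p k * Num.min (increment R a h n k) main_bound.
Proof.
set x := (n %/ (2 * h))%N => mx.
have D0 := lt_le_trans ltr01 D1.
have xn : (2 * h * x <= n)%N by rewrite mulnC leq_divM.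
have nx : (n < 2 * h * x.+1)%N by rewrite mulnC ltn_ceil // /h.
have h1x : (2 * (h1 * x) + 2 * x <= n)%N 
  by move: xn; rewrite /h mulnS mulnDl -mulnA addnC.
have mx2 : (m0 <= x)%N by natlia.
have hx : (x <= h1 * x)%N by rewrite leq_pmull.
have mn : (m0 <= n)%N by natlia.
have n0 : 0 < n%:R :> R by rewrite ltr0n; natlia.
have term0 k : 0 <= p k * Num.min (increment R a h n k) main_bound.
  rewrite mulr_ge0 ?le_min ?increment_ge0 ?(ltW main_bound_gt0) //.
  by case/andP: (p01 k).
rewrite (reindex_inj rev_ord_inj) /=.
under eq_bigr do rewrite subSS.
rewrite (@le_trans _ _ (\sum_(m < (h1 * x).+1) p (n - m)%N *
    Num.min (increment R a h n (n - m)) main_bound)) //; last first.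
  rewrite (big_ord_widen n.+1 (fun m => p (n - m)%N *
    Num.min (increment R a h n (n - m)) main_bound)); last by natlia.
  by rewrite big_mkcond; apply: ler_sum => m _; case: ifP.
rewrite (@le_trans _ _ (\sum_(m < (h1 * x).+1) G n / (D * n%:R) * rep R a h1 m)) //.
  rewrite -mulr_sumr.
  rewrite (@le_trans _ _ (G n / (D * n%:R) * (G x / (16 * D)) ^+ h1)) //; last first.
    apply: ler_wpM2l; first by rewrite divr_ge0 ?G_ge0 // mulr_ge0 // ltW.
    rewrite (le_trans _ (sum_rep_ge _ _ (leqnn _))) //.
    rewrite lerXn2r ?nnegrE ?cnt_ge0 ?cnt_lower // divr_ge0 ?G_ge0 // ?mulr_ge0 //.
    exact: ltW.
  have Gx : G n <= D ^+ (4 * h) * G x.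
    apply: G_iter => //; first by natlia.
    (* Indeed [n < 2 * h * x.+1 <= 4 * h * x], and [4 * h < 2 ^ (4 * h)]. *)
    rewrite (@leq_trans (4 * h * x)) //; first by natlia.
    by rewrite leq_mul2r ltnW ?orbT // ltn_expl.
  have E0 : 0 < D ^+ (4 * h) by rewrite exprn_gt0.
  have -> : main_const * (G n ^+ h / n%:R) =
      G n / (D * n%:R) * (G n / (16 * D * D ^+ (4 * h))) ^+ h1.
    rewrite /main_const [G n ^+ h]exprS expr_div_n.
    have : 0 < (16 * D * D ^+ (4 * h)) ^+ h1 by rewrite exprn_gt0 // !mulr_gt0.
    by move: ((16 * D * D ^+ (4 * h)) ^+ h1) (G n ^+ h1) => u v u0; field; rewrite !gt_eqF.
  apply: ler_wpM2l; first by rewrite divr_ge0 ?G_ge0 // mulr_ge0 // ltW.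
  have PE0 : 0 < 16 * D * D ^+ (4 * h) by rewrite !mulr_gt0.
  rewrite lerXn2r ?nnegrE ?divr_ge0 ?G_ge0 ?(ltW PE0) ?mulr_ge0 ?(ltW D0) //.
  rewrite ler_pdivrMr // mulrA divfK 1?mulrC // gt_eqF // mulr_gt0 //.
apply: ler_sum => m _; have := ltn_ord m; rewrite ltnS => mle.
have mn' : (m <= n)%N by natlia.
apply: ler_pM; rewrite ?rep_ge0 //.
- by rewrite divr_ge0 ?G_ge0 // mulr_ge0 // ltW.
- by apply: p_ge; natlia.
- rewrite le_min; apply/andP; split.
    have := @increment_ge_rep R a h1 n (n - m).
    by rewrite subKn //; apply; natlia.
  rewrite (le_trans (rep_level_max _)) // /main_bound ler_peMl ?(ltW (level_bound_gt0 _)) //.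
  by rewrite ler1n.
Qed.

(** A quarter of the mean survives [expRN_sub1_le4], and by [ln_main] the logarithmic error takes at
    most half of that quarter. *)
Lemma rep_lower n : (m0 <= (n %/ (2 * h))./2)%N ->
  main_const / 8 * (G n ^+ h / n%:R) <= rep R a h n.
Proof.
move=> mx; have mn : (m0 <= n)%N.
  by rewrite (leq_trans mx) // (leq_trans _ (leq_div n (2 * h))) //; natlia.
have := @deviation n (inr (inl false)) n.+1 mn; rewrite /= /sg.
under eq_bigr do rewrite mulN1r mulrN; rewrite sumrN sum_main //.
set S := \sum_(i < _) _ => dev.
have K0 : main_bound != 0 by rewrite gt_eqF.
have S_le : S <= - (main_const * (G n ^+ h / n%:R) / (4 * main_bound)).
  rewrite (@le_trans _ _ (- ((\sum_(k < n.+1) p k * Num.min (increment R a h n k) main_bound)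
     / (4 * main_bound)))) //; last first.
    rewrite lerN2; apply: ler_wpM2r; last exact: main_mean.
    by rewrite invr_ge0 mulr_ge0 // ltW.
  rewrite mulr_suml -sumrN; apply: ler_sum => i _.
  rewrite mulN1r -mulrA -[leRHS]mulrN ler_wpM2l //; first by case/andP: (p01 i).
  have inc0 := increment_ge0 R a h n i.
  set m := Num.min _ _; have -> : m / (4 * main_bound) = m / main_bound / 4 by field.
  apply: expRN_sub1_le4; rewrite /m.
  rewrite divr_ge0 ?le_min ?inc0 ?(ltW main_bound_gt0) //=.
  by rewrite ler_pdivrMr // mul1r ge_min lexx orbT.
have := le_trans dev (lerD S_le (lexx _)); have := ln_main mn.
set q := (G n ^+ h / _) => le1 le2.
have : - rep R a h n <= - (main_const * q / 4) + 2 * (main_bound * ln n%:R).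
  rewrite -(ler_pM2r (_ : 0 < main_bound^-1)) ?invr_gt0 // mulNr (le_trans le2) //.
  rewrite le_eqVlt; apply/orP; left; apply/eqP; move: (ln _) => l.
  by field.
lra.
Qed.

End Selected.
Lemma exists_selection : exists a : nat -> bool,
  [/\ forall j n, (j < h1)%N -> rep R a j.+1 n <= level_bound j,
      forall n, (m0 <= n)%N -> cnt R a n <= cnt_const * G n,
      forall n, (m0 <= n./2)%N -> G n / (16 * D) <= cnt R a n,
      forall n, (m0 <= n)%N -> rep R a h n <=
  (4 * h%:R ^+ 2 * (cnt_const + 1) ^+ h1 + main_const / 8) * (G n ^+ h / n%:R) &
      forall n, (m0 <= (n %/ (2 * h))./2)%N ->
        main_const / 8 * (G n ^+ h / n%:R) <= rep R a h n].
Proof.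
have [a [a0 sel]] := greedy_selection p01 eqU U0 w0 sum_w.
exists a; split.
- exact: rep_level.
- exact: cnt_upper.
- exact: cnt_lower.
- exact: rep_upper.
- exact: rep_lower.
Qed.

End Core.

(** * Removing the threshold conditions *)

Section Eventually.
Variable R : realType.

Lemma ln_ge_eventually (M : R) :
  exists N, forall n, (N <= n)%N -> M <= ln (n%:R : R).
Proof.
exists (Num.bound (expR M)) => n Nn.
have lt : expR M < n%:R.
  by rewrite (lt_le_trans (archi_boundP (expR_ge0 M))) // ler_nat.
rewrite -[M]expRK ler_ln ?posrE ?expR_gt0 ?ltW //.
by rewrite (lt_trans (expR_gt0 M)).
Qed.

(** For [u = ln n], [n] is the power [2 * h] of [expR v] with [v = u / (2 * h)]. As [v <= expR v],
    it suffices that [c * u <= v ^+ 2], which holds once [u >= 4 * h ^+ 2 * c]. *)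
Lemma ln_pow_le_eventually (c : R) h : 0 <= c -> (0 < h)%N ->
  exists N, forall n, (N <= n)%N -> (c * ln n%:R) ^+ h <= n%:R :> R.
Proof.
move=> c0 h0; have [N HN] := ln_ge_eventually (4 * h%:R ^+ 2 * c).
exists N.+1 => n Nn; have le := HN n (ltnW Nn).
have n0 : 0 < n%:R :> R by rewrite ltr0n (leq_trans _ Nn).
have hR : 0 < h%:R :> R by rewrite ltr0n.
set u := ln _ in le *.
have u0 : 0 <= u by rewrite (le_trans _ le) // !mulr_ge0 // exprn_ge0.
have -> : n%:R = (expR (u / (2 * h%:R)) ^+ 2) ^+ h :> R.
  rewrite -exprM -expRM_natl natrM mulrCA mulfV ?mulr1 ?lnK ?posrE //.
  by rewrite gt_eqF // mulr_gt0.
have e1 : u / (2 * h%:R) <= expR (u / (2 * h%:R)).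
  by rewrite (le_trans _ (expR_ge1Dx _)) // lerDr.
have q0 : 0 <= u / (2 * h%:R) by rewrite divr_ge0 // mulr_ge0.
rewrite lerXn2r ?nnegrE ?mulr_ge0 ?exprn_ge0 ?expR_ge0 //.
rewrite (@le_trans _ _ ((u / (2 * h%:R)) ^+ 2)) //; last first.
  by rewrite lerXn2r ?nnegrE ?expR_ge0.
rewrite expr_div_n ler_pdivlMr ?exprn_gt0 ?mulr_gt0 //.
rewrite exprMn; nra.
Qed.

(* [L] does not depend on [G]: this leaves room for replacing [G] by a large
   multiple of itself. *)
Theorem exists_set_with_representations (h1 : nat) (D g d : R) :
  (0 < h1)%N -> 1 <= D -> 0 < g -> 0 < d <= 1 ->
  exists L : R, forall (G : nat -> R) (N : nat) (C : R),
  (forall n, (N <= n)%N -> 0 < G n <= n%:R) ->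
  (forall m n, (N <= m)%N -> (m <= n)%N -> G m <= G n) ->
  (forall n, (N <= n)%N -> G (2 * n)%N <= D * G n) ->
  (forall n, (N <= n)%N -> (1 + g) * G n <= G (2 * n)%N) ->
  ((1 < h1)%N -> forall n, (N <= n)%N ->
     G n ^+ h1 * expR (2 * d * ln n%:R) <= C * n%:R) ->
  (forall n, (N <= n)%N -> L * (n%:R * ln (n%:R : R)) <= G n ^+ h1.+1) ->
  exists a : nat -> bool,
  (forall j, (j <= h1)%N -> exists K, forall n, rep R a j n <= K) /\
  exists c1 c2 N', 0 < c1 /\ forall n, (N' <= n)%N ->
    (c1 * G n <= cnt R a n <= c2 * G n) /\
    (c1 * (G n ^+ h1.+1 / n%:R) <= rep R a h1.+1 n <= c2 * (G n ^+ h1.+1 / n%:R)).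
Proof.
move=> h1_gt0 D1 g0 d01; have /andP[d0 d1] := d01.
have D0 := lt_le_trans ltr01 D1.
(* The maximum with 1 also gives [n * ln n <= G n ^+ h1.+1], from which [1 <= G n] and
   [32 * D * ln n <= G n] follow for large [n]. *)
exists (Num.max 1 (16 * main_bound h1 d / main_const h1 D)) => G N C G0 Gm Gd Gg Gs GL.
set cc := h1.+1%:R ^+ 2 * (cnt_const g + 1) ^+ h1.+1.
have [N1 HN1] := ln_ge_eventually 1.
have [N2 HN2] := @ln_pow_le_eventually (32 * D) h1.+1 (mulr_ge0 (ler0n _ _) (ltW D0)) isT.
have [N3 HN3] := ln_ge_eventually (cc * C / d).
pose m0 := (N + N1 + N2 + N3 + 2 * h1.+1 + 6)%N.
have Nm n : (m0 <= n)%N -> (N <= n)%N by lia.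
have G0' n : (m0 <= n)%N -> 0 <= G n by move=> /Nm/G0/andP[/ltW].
have ln1 n : (m0 <= n)%N -> 1 <= ln (n%:R : R) by move=> mn; apply: HN1; lia.
have nG n : (m0 <= n)%N -> n%:R <= G n ^+ h1.+1.
  move=> mn; rewrite (le_trans _ (GL n (Nm n mn))) //.
  rewrite (@le_trans _ _ (1 * (n%:R * ln n%:R))) //.
    by rewrite mul1r ler_peMr // ln1.
  by rewrite ler_wpM2r ?le_max ?lexx // mulr_ge0 // (le_trans ler01) // ln1.
have G1 n : (m0 <= n)%N -> 1 <= G n.
  move=> mn; rewrite -(@ler_pXn2r _ h1.+1) ?nnegrE ?G0' // expr1n.
  by rewrite (le_trans _ (nG n mn)) // ler1n; lia.
have GLn n : (m0 <= n)%N -> 32 * D * ln (n%:R : R) <= G n.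
  move=> mn; have := ln1 n mn => l1.
  rewrite -(@ler_pXn2r _ h1.+1) ?nnegrE ?G0' ?mulr_ge0 ?(ltW D0) ?(le_trans ler01 l1) //.
  by rewrite (le_trans _ (nG n mn)) // HN2 //; lia.
have [] := @exists_selection R h1 G D g d m0 h1_gt0 D1 g0 d01.
- by rewrite /m0; lia.
- exact: G1.
- by move=> n /Nm/G0/andP[].
- by move=> m n /Nm; apply: Gm.
- by move=> n /Nm/Gd.
- by move=> n /Nm/Gg.
- exact: ln1.
- exact: GLn.
(* Half of the exponent [2 * d] is spent on the constant [cc * C], which is at most
   [expR (d * ln n)] for large [n]. *)
- move=> h1' n mn; rewrite -/cc.
  have le1 := Gs h1' n (Nm n mn).
  have le2 : cc * C / d <= ln n%:R by apply: HN3; lia.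
  have cc0 : 0 < cc.
    rewrite mulr_gt0 ?exprn_gt0 ?ltr0n // addr_gt0 //.
    by rewrite /cnt_const divr_gt0 // mulr_gt0 // addr_gt0.
  have e0 := expR_gt0 (d * ln (n%:R : R)).
  rewrite -(ler_pM2r e0).
  have -> : cc * G n ^+ h1 * expR (d * ln n%:R) * expR (d * ln n%:R) =
      cc * (G n ^+ h1 * expR (2 * d * ln n%:R)).
    have -> : 2 * d * ln n%:R = d * ln n%:R + d * ln n%:R by ring.
    by rewrite expRD !mulrA.
  rewrite (le_trans (ler_wpM2l (ltW cc0) le1)) // mulrA mulrC ler_wpM2l //.
  move: le2; rewrite ler_pdivrMr // mulrC => /le_trans; apply.
  by rewrite (le_trans _ (expR_ge1Dx _)) // mulrC lerDr.
- move=> n mn; rewrite (le_trans _ (GL n (Nm n mn))) //.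
  rewrite ler_wpM2r ?le_max ?lexx ?orbT // mulr_ge0 // (le_trans ler01) // ln1 //.
move=> a [a_lev a_cu a_cl a_ru a_rl].
have mc0 : 0 < main_const h1 D.
  by rewrite /main_const mulr_gt0 ?invr_gt0 ?exprn_gt0 ?mulr_gt0 ?exprn_gt0.
exists a; split.
  case=> [|j] jh; last by exists (level_bound d j) => n; apply: a_lev.
  by exists 1 => n; rewrite rep0 lern1 leq_b1.
set c3 := (_ + main_const h1 D / 8) in a_ru.
exists (Num.min (16 * D)^-1 (main_const h1 D / 8)), (Num.max (cnt_const g) c3), (2 * h1.+1 * (2 * m0 + 2))%N.
split; first by rewrite lt_min invr_gt0 mulr_gt0 //= divr_gt0.
move=> n Nn.
have mx : (m0 <= (n %/ (2 * h1.+1))./2)%N.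
  have : ((2 * m0 + 2) <= n %/ (2 * h1.+1))%N by rewrite leq_divRL // mulnC.
  lia.
have mn2 : (m0 <= n./2)%N.
  by rewrite (leq_trans mx) // half_leq // leq_div.
have mn : (m0 <= n)%N by lia.
have q0 : 0 <= G n ^+ h1.+1 / n%:R by rewrite divr_ge0 // exprn_ge0 // G0'.
split; apply/andP; split.
- by rewrite (le_trans _ (a_cl n mn2)) // mulrC ler_wpM2l ?G0' // ge_min lexx.
- by rewrite (le_trans (a_cu n mn)) // ler_wpM2r ?G0' // le_max lexx.
- by rewrite (le_trans _ (a_rl n mx)) // ler_wpM2r // ge_min lexx orbT.
- by rewrite (le_trans (a_ru n mn)) // ler_wpM2r // le_max lexx orbT.
Qed.

End Eventually.

(** * Adding an initial segment *)

Section Enlarge.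
Variables (R : realType) (a : nat -> bool) (M : nat).

Definition enlarge i := a i || (i <= M)%N.

Let extra i := (i <= M)%N && ~~ a i.

Let sum_extra n : \sum_(k < n) (extra k)%:R <= M.+1%:R :> R.
Proof.
apply: (@le_trans _ _ (\sum_(k < n) (k < M.+1)%N%:R)).
  apply: ler_sum => k _; rewrite ler_nat /extra ltnS.
  by case: (k <= M)%N; case: (a k).
suff -> : \sum_(k < n) (k < M.+1)%N%:R = (minn n M.+1)%:R :> R.
  by rewrite ler_nat geq_minr.
elim: n => [|n IH]; first by rewrite big_ord0 min0n.
by rewrite big_ord_recr IH /= -natrD; congr (_%:R); natlia.
Qed.

Lemma cnt_enlarge_ge n : cnt R a n <= cnt R enlarge n.
Proof. by apply: ler_sum => k _; rewrite ler_nat /enlarge; case: (a k). Qed.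

Lemma cnt_enlarge_le n : cnt R enlarge n <= cnt R a n + M.+1%:R.
Proof.
rewrite (le_trans _ (lerD (lexx _) (sum_extra n.+1))) // -big_split /=.
apply: ler_sum => k _; rewrite -natrD ler_nat /enlarge /extra.
by case: (a k); case: (k <= M)%N.
Qed.

Lemma rep_enlarge_ge j n : rep R a j n <= rep R enlarge j n.
Proof. by apply: rep_mono => i _; rewrite /enlarge => ->. Qed.

(** There are at most [M.+1] new elements, each with [j.+1] possible positions and at most [K]
    completions. *)
Lemma rep_enlarge_le j n K : (forall m, rep R enlarge j m <= K) ->
  rep R enlarge j.+1 n <= rep R a j.+1 n + j.+1%:R * (M.+1%:R * K).
Proof.
move=> HK.
have K0 : 0 <= K by exact: le_trans (rep_ge0 R enlarge j 0) (HK 0%N).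
have cE i : enlarge i = a i || extra i.
  by rewrite /enlarge /extra; case: (a i); rewrite ?andbT.
have dis i : ~~ (a i && extra i) by rewrite /extra; case: (a i); rewrite ?andbF.
rewrite (le_trans (rep_split_le R cE dis j n)) // lerD2l ler_wpM2l //.
apply: (@le_trans _ _ (\sum_(k < n.+1) (extra k)%:R * K)).
  by apply: ler_sum => k _; rewrite ler_wpM2l.
by rewrite -mulr_suml ler_wpM2r // sum_extra.
Qed.

Lemma rep_enlarge_bounded h :
  (forall j, (j <= h)%N -> exists K, forall n, rep R a j n <= K) ->
  forall j, (j <= h)%N -> exists K, forall n, rep R enlarge j n <= K.
Proof.
move=> aK; elim=> [|j IH] jh.
  by exists 1 => n; rewrite rep0 lern1 leq_b1.
have [K HK] := aK _ jh; have [K' HK'] := IH (ltnW jh).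
exists (K + j.+1%:R * (M.+1%:R * K')) => n.
by rewrite (le_trans (rep_enlarge_le n HK')) // lerD2r.
Qed.

End Enlarge.

(** * One more summand *)

Section AddSummand.
Variables (R : realType) (b : nat -> bool) (G : nat -> R) (c C : R) (N : nat).
Hypothesis N0 : (0 < N)%N.
Hypothesis G0 : forall n, (N <= n)%N -> 0 < G n.
Hypothesis G_mono : forall m n, (N <= m)%N -> (m <= n)%N -> G m <= G n.
Hypothesis cntG : forall n, (N <= n)%N -> c * G n <= cnt R b n <= C * G n.

(* Every representation with [j.+1] summands has a summand at most
   [n %/ j.+1], so only the values of [rep b j] on [[n/2, n]] matter. *)
Lemma rep_add_summand_le j C' : (0 < j)%N ->
  (forall n, (N <= n)%N -> rep R b j n <= C' * (G n ^+ j / n%:R)) ->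
  forall n, (2 * N <= n)%N ->
  rep R b j.+1 n <= (j.+1%:R * C * (2 * C')) * (G n ^+ j.+1 / n%:R).
Proof.
move=> j0 H n Nn; pose x := (n %/ j.+1)%N.
have Nn' : (N <= n)%N by natlia.
have n0 : 0 < n%:R :> R by rewrite ltr0n; natlia.
have x2 : (2 * x <= n)%N.
  by rewrite (@leq_trans (x * j.+1)) ?leq_divM // mulnC leq_mul2l ltnS j0 orbT.
have C'0 : 0 <= C'.
  have := le_trans (rep_ge0 R b j N) (H N (leqnn N)).
  by rewrite pmulr_lge0 // divr_gt0 ?exprn_gt0 ?G0 // ltr0n.
pose small i := b i && (i <= x)%N; pose large i := b i && (x < i)%N.
have cE i : b i = large i || small i.
  by rewrite /large /small; case: (b i) => //=; case: leqP.
have dis i : ~~ (large i && small i).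
  by rewrite /large /small; case: (b i) => //=; case: leqP.
rewrite (le_trans (rep_split_le R cE dis j n)) //.
rewrite (@rep_lt_support _ _ _ x.+1); last 2 first.
- by move=> i /andP[].
- by rewrite mulnC ltn_ceil.
rewrite add0r.
have term (k : 'I_n.+1) : (small k)%:R * rep R b j (n - k) <=
    (b k)%:R * (2 * C' * (G n ^+ j / n%:R)).
  case: (boolP (small k)) => [/andP[-> kx]|_]; last first.
    by rewrite mul0r !mulr_ge0 ?invr_ge0 ?exprn_ge0 // ltW ?G0.
  rewrite !mul1r (le_trans (H _ _)) //; first by natlia.
  have nk0 : 0 < (n - k)%N%:R :> R by rewrite ltr0n; natlia.
  have -> : 2 * C' * (G n ^+ j / n%:R) = C' * (G n ^+ j * (2 / n%:R)) by ring.
  rewrite ler_wpM2l // ler_pM ?exprn_ge0 ?invr_ge0 ?(ltW nk0) //.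
  - by rewrite ltW // G0 //; natlia.
  - rewrite lerXn2r ?nnegrE ?(ltW (G0 _)) //; try natlia.
    by apply: G_mono; natlia.
  - rewrite ler_pdivlMr // mulrC ler_pdivrMr // -natrM ler_nat; natlia.
rewrite -!mulrA ler_wpM2l // (le_trans (ler_sum _ (fun k _ => term k))) //.
rewrite -mulr_suml -/(cnt R b n).
have /andP[_ le] := cntG Nn'.
have q0 : 0 <= 2 * C' * (G n ^+ j / n%:R).
  by rewrite !mulr_ge0 ?invr_ge0 ?exprn_ge0 // ltW ?G0.
rewrite (le_trans (ler_wpM2r q0 le)) // le_eqVlt; apply/orP; left; apply/eqP.
by rewrite exprS; ring.
Qed.

Variable D : R.
Hypothesis c0 : 0 < c.
Hypothesis D1 : 1 <= D.
Hypothesis G_double : forall n, (N <= n)%N -> G (2 * n)%N <= D * G n.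

Let D0 : 0 < D. Proof. exact: lt_le_trans ltr01 D1. Qed.

(** Only first summands [k <= n./2] are kept. For these [n <= 2 * (n - k)], so doubling bounds
    [G (n - k)] below by [G n / D]; their number is at least [c * G n / D ^+ 2]. *)
Lemma rep_add_summand_ge j c' : 0 < c' ->
  (forall n, (N <= n)%N -> c' * (G n ^+ j / n%:R) <= rep R b j n) ->
  forall n, (2 * N + 1 < n)%N ->
  (c * c' * D ^- j.+2) * (G n ^+ j.+1 / n%:R) <= rep R b j.+1 n.
Proof.
move=> c'0 H n Nn.
have Nn' : (N <= n)%N by natlia.
have n0 : 0 < n%:R :> R by rewrite ltr0n; natlia.
have Nh : (N <= n./2)%N by natlia.
rewrite repS.
apply: (@le_trans _ _ (\sum_(k < n.+1 | (k < n./2.+1)%N)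
    (b k)%:R * (c' * ((G n / D) ^+ j / n%:R)))).
  rewrite -(big_ord_widen n.+1 (fun k => (b k)%:R * (c' * ((G n / D) ^+ j / n%:R))));
    last by natlia.
  rewrite -mulr_suml -/(cnt R b n./2).
  have /andP[le _] := cntG Nh.
  have q0 : 0 <= c' * ((G n / D) ^+ j / n%:R).
    by rewrite !mulr_ge0 ?invr_ge0 ?exprn_ge0 ?divr_ge0 // ltW ?G0.
  rewrite (le_trans _ (ler_wpM2r q0 le)) //.
  (* Two doublings are used because [n] may exceed [2 * n./2]. *)
  have Gh : G n / D ^+ 2 <= G n./2.
    rewrite ler_pdivrMr ?exprn_gt0 // mulrC expr2 -mulrA.
    rewrite (le_trans (G_mono Nn' (_ : _ <= 2 * (2 * n./2))%N)) //; first by natlia.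
    rewrite (le_trans (G_double _)) //; first by natlia.
    by rewrite ler_pM2l // G_double.
  have q1 : 0 <= c * (c' * ((G n / D) ^+ j / n%:R)) by rewrite mulr_ge0 // ltW.
  apply: (@le_trans _ _ (c * (c' * ((G n / D) ^+ j / n%:R)) * (G n / D ^+ 2))).
    rewrite le_eqVlt; apply/orP; left; apply/eqP.
    rewrite expr_div_n [G n ^+ j.+1]exprS -[j.+2]addn2 exprD.
    have : 0 < D ^+ j by rewrite exprn_gt0.
    move: (D ^+ j) (G n ^+ j) => u v u0; field.
    by rewrite !gt_eqF.
  rewrite (le_trans (ler_wpM2l q1 Gh)) // le_eqVlt; apply/orP; left; apply/eqP.
  by ring.
rewrite big_mkcond; apply: ler_sum => k _; case: ifP => kh; last first.
  by rewrite mulr_ge0 // rep_ge0.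
rewrite ler_wpM2l // (le_trans _ (H _ _)) //; last by natlia.
have nk0 : 0 < (n - k)%N%:R :> R by rewrite ltr0n; natlia.
rewrite ler_pM2l // ler_pM ?exprn_ge0 ?divr_ge0 ?invr_ge0 ?(ltW n0) ?(ltW D0) ?(ltW (G0 _)) //.
- rewrite lerXn2r ?nnegrE ?divr_ge0 ?(ltW D0) ?(ltW (G0 _)) //; try natlia.
  rewrite ler_pdivrMr // mulrC (le_trans (G_mono Nn' (_ : _ <= 2 * (n - k))%N)) //; first by natlia.
  by apply: G_double; natlia.
- by rewrite lef_pV2 ?posrE // ler_nat; natlia.
Qed.

End AddSummand.

(** * From a growth profile to a basis of exact order *)

Section Basis.
Variables (R : realType) (h1 : nat) (F : nat -> R) (D g e B : R) (N : nat).
Let h := h1.+1.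
Hypothesis h1_gt0 : (0 < h1)%N.
Hypothesis D1 : 1 <= D.
Hypothesis g01 : 0 < g <= 1.
Hypothesis e01 : 0 < e <= 1.
Hypothesis B0 : 0 < B.
Hypothesis F0 : forall n, (N <= n)%N -> 0 < F n.
Hypothesis F_mono : forall m n, (N <= m)%N -> (m <= n)%N -> F m <= F n.
Hypothesis F_double : forall n, (N <= n)%N -> F (2 * n)%N <= D * F n.
Hypothesis F_grow : forall n, (N <= n)%N -> (1 + g) * F n <= F (2 * n)%N.
Hypothesis F_le : forall n, (N <= n)%N -> F n <= B * n%:R.
Hypothesis F_dense : forall n, (N <= n)%N ->
  n%:R * ln n%:R <= B * F n ^+ h.
Hypothesis F_sparse : (1 < h1)%N -> forall n, (N <= n)%N ->
  F n ^+ h1 * expR (2 * e * ln n%:R) <= B * n%:R.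

(* Multiplying [F] by a large constant makes the expected number of
   representations dominate [ln n]; the minimum keeps [G n / n] a
   probability. *)
Lemma exists_scaled_profile (L : R) : exists (G : nat -> R) (C : R) (N' : nat),
  ((N <= N')%N /\ (0 < N')%N) /\
  [/\ forall n, (N' <= n)%N -> 1 <= G n <= n%:R,
      forall m n, (N' <= m)%N -> (m <= n)%N -> G m <= G n,
      forall n, (N' <= n)%N -> G (2 * n)%N <= (D + 1) * G n,
      forall n, (N' <= n)%N -> (1 + g) * G n <= G (2 * n)%N &
  [/\ (1 < h1)%N -> forall n, (N' <= n)%N ->
        G n ^+ h1 * expR (2 * e * ln n%:R) <= C * n%:R,
      forall n, (N' <= n)%N -> L * (n%:R * ln (n%:R : R)) <= G n ^+ h,
      forall n, (N' <= n)%N -> n%:R <= G n ^+ h &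
      0 < C /\ forall n, (N' <= n)%N -> G n <= C * F n /\ F n <= C * G n]].
Proof.
have D0 := lt_le_trans ltr01 D1.
set L' := Num.max 1 L; have L'1 : 1 <= L' by rewrite le_max lexx.
(* As [L' * B <= T ^+ h], [F_dense] yields the required density for [T * F n]. *)
set T := Num.max 1 (L' * B).
have T1 : 1 <= T by rewrite le_max lexx.
have T0 : 0 < T by exact: lt_le_trans ltr01 T1.
have LT : L' * B <= T ^+ h.
  by rewrite (@le_trans _ _ T) ?le_max ?lexx ?orbT // ler_eXnr.
have [N1 HN1] := ln_ge_eventually (1 : R).
have [N2 HN2] := @ln_pow_le_eventually R L' 1 (le_trans ler01 L'1) isT.
pose N' := (N + N1 + N2 + 1)%N.
have NN' n : (N' <= n)%N -> (N <= n)%N by natlia.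
have n0 n : (N' <= n)%N -> 0 < n%:R :> R by move=> mn; rewrite ltr0n; natlia.
have ln1 n : (N' <= n)%N -> 1 <= ln (n%:R : R) by move=> mn; apply: HN1; natlia.
pose G n := Num.min n%:R (T * F n).
have TF0 n : (N' <= n)%N -> 0 < T * F n by move=> /NN'/F0; apply: mulr_gt0.
have G0 n : (N' <= n)%N -> 0 < G n by move=> mn; rewrite lt_min n0 ?TF0.
have GL' n : (N' <= n)%N -> L' * (n%:R * ln (n%:R : R)) <= G n ^+ h.
  move=> mn; have Nn := NN' n mn; have l1 := ln1 n mn; have nn := n0 n mn.
  have [->|->] : G n = n%:R \/ G n = T * F n.
      by rewrite /G minEle; case: ifP; [left|right].
    rewrite (@le_trans _ _ (n%:R ^+ 2)) //.
      rewrite mulrCA expr2 ler_pM2l //.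
      by have := HN2 n; rewrite expr1; apply; natlia.
    by rewrite ler_weXn2l // ler1n; natlia.
  rewrite exprMn (@le_trans _ _ (L' * (B * F n ^+ h))) //.
    by rewrite ler_wpM2l ?F_dense // (le_trans ler01).
  by rewrite mulrA ler_wpM2r // exprn_ge0 // ltW // F0.
have nG n : (N' <= n)%N -> n%:R <= G n ^+ h.
  move=> mn; rewrite (le_trans _ (GL' n mn)) // mulrCA ler_peMr ?(ltW (n0 n mn)) //.
  by rewrite mulr_ege1 // ln1.
exists G, (Num.max (Num.max T (B + 1)) (T ^+ h1 * B)), N'; split; first by natlia.
have TF n : (N' <= n)%N -> G n <= T * F n by move=> mn; rewrite ge_min lexx orbT.
split; [| | | |split].
- move=> n mn; rewrite ge_min lexx /= andbT.
  rewrite -(@ler_pXn2r _ h) ?nnegrE ?(ltW (G0 _ _)) // expr1n.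
  by rewrite (le_trans _ (nG n mn)) // ler1n; natlia.
- move=> m n Nm mn; rewrite le_min !ge_min ler_nat mn /=.
  by rewrite (ler_pM2l T0) F_mono ?orbT // NN'.
(* The constant [D + 1] is at least 2, which covers the case where the minimum is [n]. *)
- move=> n mn; rewrite /G [(D + 1) * _]minr_pMr; last by rewrite addr_ge0 // ltW.
  rewrite le_min !ge_min; apply/andP; split; apply/orP; [left|right].
    by rewrite natrM ler_wpM2r // (_ : 2 = 1 + 1) // lerD2r.
  rewrite mulrCA (ler_pM2l T0) (le_trans (F_double _)) ?NN' //.
  by rewrite ler_wpM2r ?lerDl // ltW // F0 // NN'.
- move=> n mn; case/andP: g01 => gp g1.
  rewrite /G minr_pMr; last by rewrite addr_ge0 // ltW.
  rewrite le_min !ge_min; apply/andP; split; apply/orP; [left|right].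
    by rewrite natrM ler_wpM2r // (_ : 2 = 1 + 1) // lerD2l.
  by rewrite mulrCA (ler_pM2l T0) F_grow // NN'.
- move=> h1' n mn; rewrite (@le_trans _ _ (T ^+ h1 * B * n%:R)) //; last first.
    by rewrite ler_wpM2r // le_max lexx orbT.
  rewrite -[leRHS]mulrA (le_trans _ (ler_wpM2l (exprn_ge0 _ (ltW T0)) (F_sparse h1' (NN' n mn)))) //.
  rewrite mulrA -exprMn ler_wpM2r ?expR_ge0 // lerXn2r ?nnegrE ?(ltW (G0 _ _)) ?TF //.
  by rewrite ltW // TF0.
- move=> n mn; rewrite (le_trans _ (GL' n mn)) // ler_wpM2r ?le_max ?lexx ?orbT //.
  by rewrite mulr_ge0 // (le_trans ler01) // ln1.
- exact: nG.
- split; first by rewrite lt_max; apply/orP; left; rewrite lt_max T0.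
  move=> n mn; have Fp := F0 (NN' n mn); split.
    rewrite (le_trans (TF n mn)) // ler_wpM2r ?(ltW Fp) //.
    by rewrite le_max; apply/orP; left; rewrite le_max lexx.
  rewrite (@le_trans _ _ ((B + 1) * G n)) //; last first.
    rewrite ler_wpM2r ?(ltW (G0 _ _)) // le_max; apply/orP; left.
    by rewrite le_max lexx orbT.
  rewrite minr_pMr; last by rewrite addr_ge0 // ltW.
  rewrite le_min; apply/andP; split.
    by rewrite (le_trans (F_le _)) ?NN' // ler_wpM2r // lerDl.
  rewrite mulrA ler_peMl ?(ltW Fp) // mulr_ege1 // lerDr ltW //.
Qed.

Lemma exists_basis : exists b : nat -> bool,
  [/\ forall n, 0 < rep R b h n,
      forall k, (1 < k < h)%N -> exists n, rep R b k n < 1,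
      exists2 C, 0 < C & exists N', forall n, (N' <= n)%N ->
        cnt R b n <= C * F n /\ F n <= C * cnt R b n &
      forall l, exists2 C, 0 < C & exists N', forall n, (N' <= n)%N ->
        rep R b (h + l) n <= C * (F n ^+ (h + l) / n%:R) /\
        F n ^+ (h + l) / n%:R <= C * rep R b (h + l) n].
Proof.
have D1' : 1 <= D + 1 by rewrite lerDr (le_trans ler01).
have g0 : 0 < g by case/andP: g01.
have [L HL] := exists_set_with_representations h1_gt0 D1' g0 e01.
have [G [C [N1 [[NN1 N1_gt0] [G1n Gm Gd Gg [Gs GL nG [C0 GF]]]]]]] := exists_scaled_profile L.
have G1 n : (N1 <= n)%N -> 1 <= G n by move=> /G1n/andP[].
have G0 n : (N1 <= n)%N -> 0 < G n by move=> /G1; apply: lt_le_trans.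
have [a [a_bd [c1 [c2 [N2 [c1_gt0 a_reg]]]]]] : exists a : nat -> bool,
  (forall j, (j <= h1)%N -> exists K, forall n, rep R a j n <= K) /\
  exists c1 c2 N', 0 < c1 /\ forall n, (N' <= n)%N ->
    (c1 * G n <= cnt R a n <= c2 * G n) /\
    (c1 * (G n ^+ h1.+1 / n%:R) <= rep R a h1.+1 n <= c2 * (G n ^+ h1.+1 / n%:R)).
  apply: (HL G N1 C) => // n Nn.
  by rewrite G0 //=; case/andP: (G1n n Nn).
pose M := (N1 + N2)%N; pose b := enlarge a M.
have n0 n : (M <= n)%N -> 0 < n%:R :> R by move=> Mn; rewrite ltr0n; natlia.
have MN1 n : (M <= n)%N -> (N1 <= n)%N by natlia.
have MN2 n : (M <= n)%N -> (N2 <= n)%N by natlia.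
have b_bd := rep_enlarge_bounded M a_bd.
have [K HK] := b_bd h1 (leqnn _).
have K0 : 0 <= K by exact: le_trans (rep_ge0 R b h1 0) (HK 0%N).
have q1 n : (M <= n)%N -> 1 <= G n ^+ h / n%:R.
  by move=> Mn; rewrite ler_pdivlMr ?n0 // mul1r nG // MN1.
set c3 := c2 + M.+1%:R; set c4 := c2 + h%:R * (M.+1%:R * K).
have b_cnt n : (M <= n)%N -> c1 * G n <= cnt R b n <= c3 * G n.
  move=> Mn; have [/andP[le1 le2] _] := a_reg n (MN2 n Mn).
  rewrite (le_trans le1 (cnt_enlarge_ge R a M n)) /=.
  rewrite (le_trans (cnt_enlarge_le R a M n)) // mulrDl lerD //.
  by rewrite ler_peMr // G1 // MN1.
have b_lo n : (M <= n)%N -> c1 * (G n ^+ h / n%:R) <= rep R b h n.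
  move=> Mn; have [_ /andP[le1 _]] := a_reg n (MN2 n Mn).
  exact: le_trans le1 (rep_enlarge_ge R a M h n).
have b_up n : (M <= n)%N -> rep R b h n <= c4 * (G n ^+ h / n%:R).
  move=> Mn; have [_ /andP[_ le2]] := a_reg n (MN2 n Mn).
  rewrite (le_trans (rep_enlarge_le n HK)) // mulrDl lerD // ler_peMr ?q1 //.
  by rewrite !mulr_ge0.
exists b; split.
(* Beyond [M] the lower bound is positive; up to [M], both 0 and [n] lie in the enlarged set. *)
- move=> n; have [nM|Mn] := leqP n M; last first.
    rewrite (lt_le_trans _ (b_lo n (ltnW Mn))) // mulr_gt0 //.
    by rewrite (lt_le_trans ltr01) // q1 // ltnW.
  have z0 : b 0%N by rewrite /b /enlarge leq0n orbT.
  have zn : b n by rewrite /b /enlarge nM orbT.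
  have rep_00 j : 0 < rep R b j 0.
    elim: j => [|j IH]; first by rewrite rep0.
    by rewrite repS big_ord1 z0 mul1r subnn.
  rewrite /h repS big_ord_recr /= subnn zn mul1r ltr_wpDl // sumr_ge0 // => i _.
  by rewrite mulr_ge0 // rep_ge0.
(* If every number were a sum of [k <= h1] elements, then [n.+1 <= cnt b n ^+ k], at most a constant
   times [G n ^+ h1]; by sparsity this is at most [n] for a suitable [n]. *)
- move=> k /andP[k1 kh]; rewrite /h in kh.
  have h1' : (1 < h1)%N by natlia.
  set c5 := (c3 + 1) ^+ h1 * C.
  have [N3 HN3] := ln_ge_eventually (c5 / (2 * e)).
  pose n := (M + N3 + 1)%N.
  have Mn : (M <= n)%N by natlia.
  have c3_gt0 : 0 <= c3.
    have /andP[le1 le2] := b_cnt n Mn.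
    have := le_trans le1 le2; rewrite (ler_pM2r (G0 n (MN1 n Mn))).
    by apply: le_trans; apply: ltW.
  apply: contrapT => none.
  have all1 m : 1 <= rep R b k m.
    by rewrite leNgt; apply/negP => lt1; apply: none; exists m.
  have le1 : n.+1%:R <= cnt R b n ^+ k.
    rewrite (le_trans _ (sum_rep_le R b k n)) //.
    rewrite -[n.+1 in leLHS]card_ord -sumr_const; exact: ler_sum.
  have /andP[_ le2] := b_cnt n Mn.
  have C31 : 0 <= c3 + 1 by rewrite ler_wpDl.
  have Gp : 0 <= G n by rewrite ltW // G0 // MN1.
  have le3 : cnt R b n ^+ k <= (c3 + 1) ^+ h1 * G n ^+ h1.
    rewrite -exprMn (@le_trans _ _ (((c3 + 1) * G n) ^+ k)) //.
      rewrite lerXn2r ?nnegrE ?cnt_ge0 //.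
        exact: mulr_ge0.
      by rewrite (le_trans le2) // ler_wpM2r // lerDl.
    rewrite ler_weXn2l //.
    rewrite mulr_ege1 ?(G1 _ (MN1 n Mn)) //.
    by rewrite lerDr.
  have le4 := Gs h1' n (MN1 n Mn).
  case/andP: e01 => e_gt0 _.
  have le5 : c5 <= expR (2 * e * ln n%:R).
    have := HN3 n; rewrite ler_pdivrMr ?mulr_gt0 // => le6.
    have := le6 ltac:(natlia) => {}le6.
    rewrite (le_trans le6) // mulrC (le_trans _ (expR_ge1Dx _)) // lerDr //.
  have E0 := expR_gt0 (2 * e * ln n%:R).
  have le7 : n.+1%:R * expR (2 * e * ln n%:R) <= c5 * n%:R.
    rewrite (@le_trans _ _ ((c3 + 1) ^+ h1 * (G n ^+ h1 * expR (2 * e * ln n%:R)))) //.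
      by rewrite mulrA ler_wpM2r ?(ltW E0) // (le_trans le1).
    by rewrite /c5 -[leRHS]mulrA ler_wpM2l // exprn_ge0.
  have := le_trans le7 (ler_wpM2r (ltW (n0 n Mn)) le5).
  by rewrite mulrC ler_pM2l // ler_nat ltnn.
- exists (Num.max (`|c3| * C) (C / c1)).
    by rewrite lt_max [X in _ || X]divr_gt0 // orbT.
  exists M => n Mn; have /andP[le1 le2] := b_cnt n Mn.
  have [GF1 GF2] := GF n (MN1 n Mn).
  have Fp : 0 <= F n by rewrite ltW // F0 // (leq_trans NN1) // MN1.
  have Gp : 0 <= G n by rewrite ltW // G0 // MN1.
  split.
    rewrite (le_trans le2) // (@le_trans _ _ (`|c3| * C * F n)) //.
      rewrite -[leRHS]mulrA (@le_trans _ _ (`|c3| * G n)) //.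
        by rewrite ler_wpM2r // ler_norm.
      by rewrite ler_wpM2l.
    by rewrite ler_wpM2r // le_max lexx.
  rewrite (le_trans GF2) // (@le_trans _ _ (C / c1 * cnt R b n)) //.
    by rewrite -mulrA ler_wpM2l ?(ltW C0) // ler_pdivlMl.
  by rewrite ler_wpM2r ?cnt_ge0 // le_max lexx orbT.
- have Gd' n : (M <= n)%N -> G (2 * n)%N <= (D + 1) * G n by move=> /MN1/Gd.
  have Gm' m n : (M <= m)%N -> (m <= n)%N -> G m <= G n by move=> /MN1; apply: Gm.
  have G0' n : (M <= n)%N -> 0 < G n by move=> /MN1/G0.
  have main l : exists c c' N', [/\ 0 < c, (0 < N')%N, (M <= N')%N &
      forall n, (N' <= n)%N ->
      c * (G n ^+ (h + l) / n%:R) <= rep R b (h + l) n <= c' * (G n ^+ (h + l) / n%:R)].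
    elim: l => [|l [c [c' [N' [c_gt0 N'_gt0 MN' IH]]]]].
      exists c1, c4, M; rewrite addn0; split=> //; first by natlia.
      by move=> n Mn; rewrite b_lo // b_up.
    have W n : (N' <= n)%N -> (M <= n)%N by exact: leq_trans.
    have G0W n : (N' <= n)%N -> 0 < G n by move=> /W/G0'.
    have GmW m n : (N' <= m)%N -> (m <= n)%N -> G m <= G n by move=> /W; apply: Gm'.
    have GdW n : (N' <= n)%N -> G (2 * n)%N <= (D + 1) * G n by move=> /W/Gd'.
    have cntW n : (N' <= n)%N -> c1 * G n <= cnt R b n <= c3 * G n by move=> /W/b_cnt.
    have up n : (N' <= n)%N -> rep R b (h + l) n <= c' * (G n ^+ (h + l) / n%:R).
      by move=> /IH/andP[].
    have lo n : (N' <= n)%N -> c * (G n ^+ (h + l) / n%:R) <= rep R b (h + l) n.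
      by move=> /IH/andP[].
    have hl0 : (0 < h + l)%N by rewrite /h.
    have UP := rep_add_summand_le N'_gt0 G0W GmW cntW hl0 up.
    have LO := rep_add_summand_ge N'_gt0 G0W GmW cntW c1_gt0 D1' GdW c_gt0 lo.
    rewrite addnS.
    eexists; eexists; exists (2 * N' + 2)%N; split; last first.
    + move=> n Nn; apply/andP; split; [apply: LO|apply: UP]; natlia.
    + by natlia.
    + by natlia.
    + by rewrite !mulr_gt0 // invr_gt0 exprn_gt0 // (lt_le_trans ltr01).
  move=> l; have [c [c' [N' [c_gt0 _ MN' H]]]] := main l.
  exists (Num.max (`|c'| * C ^+ (h + l)) (C ^+ (h + l) / c)).
    by rewrite lt_max [X in _ || X]divr_gt0 ?exprn_gt0 // orbT.
  exists N' => n Nn; have /andP[le1 le2] := H n Nn.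
  have Mn := leq_trans MN' Nn.
  have [GF1 GF2] := GF n (MN1 n Mn).
  have Fp : 0 <= F n by rewrite ltW // F0 // (leq_trans NN1) // MN1.
  have Gp : 0 <= G n by rewrite ltW // G0 // MN1.
  have q0 : 0 <= F n ^+ (h + l) / n%:R by rewrite divr_ge0 // exprn_ge0.
  have qG : 0 <= G n ^+ (h + l) / n%:R by rewrite divr_ge0 // exprn_ge0.
  split.
    rewrite (le_trans le2) // (@le_trans _ _ (`|c'| * C ^+ (h + l) * (F n ^+ (h + l) / n%:R))) //.
      rewrite -[leRHS]mulrA (@le_trans _ _ (`|c'| * (G n ^+ (h + l) / n%:R))) //.
        by rewrite ler_wpM2r // ler_norm.
      rewrite ler_wpM2l // mulrA -exprMn ler_wpM2r ?invr_ge0 // lerXn2r ?nnegrE //.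
      by rewrite mulr_ge0 // ltW.
    by rewrite ler_wpM2r // le_max lexx.
  rewrite (@le_trans _ _ (C ^+ (h + l) / c * rep R b (h + l) n)) //.
    rewrite -mulrA (@le_trans _ _ (C ^+ (h + l) * (G n ^+ (h + l) / n%:R))) //.
      rewrite mulrA -exprMn ler_wpM2r ?invr_ge0 // lerXn2r ?nnegrE //.
      by rewrite mulr_ge0 // ltW.
    by rewrite ler_wpM2l ?exprn_ge0 ?(ltW C0) // ler_pdivlMl.
  by rewrite ler_wpM2r ?rep_ge0 // le_max lexx orbT.
Qed.

End Basis.

(** * The primitive of f(t)/t *)

Section Primitive.
Variable R : realType.
Notation mu := (@completed_lebesgue_measure R).
Local Notation completed_type :=
  (caratheodory_type (wlength (idfun : R -> R))^*%mu).

Lemma completed_measurable (A : set R) :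
  measurable A -> measurable (A : set completed_type).
Proof. exact: sub_caratheodory. Qed.

Lemma completed_measurable_fun (D : set R) (f : R -> R) : measurable D ->
  measurable_fun D f -> measurable_fun (D : set completed_type) f.
Proof. by move=> mD mf _ Y mY; exact: completed_measurable (mf mD Y mY). Qed.

Lemma completed_itv (x y : R) b : x <= y ->
  mu [set` Interval (BSide b x) (BRight y)] = (y - x)%:E.
Proof.
move=> xy.
transitivity (@lebesgue_measure R [set` Interval (BSide b x) (BRight y)]).
  by [].
rewrite lebesgue_measure_itv /= lte_fin; case: ltP => [//|yx].
by rewrite (@le_anti _ _ x y) ?xy // subrr.
Qed.

Variables (x0 : R) (f : R -> R).
Hypothesis x0_gt0 : 0 < x0.
Hypothesis int_f : locally_integrable_on `[x0, +oo[ f.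

Let mitv (i : interval R) : measurable (([set` i] : set R) : set completed_type).
Proof. by apply: completed_measurable; apply: measurable_itv. Qed.

(** On [[x0, y]] the factor [t^-1] is at most [x0^-1]. *)
Lemma integrable_fdiv y : mu.-integrable `[x0, y] (EFin \o (fun t => f t / t)).
Proof.
have intf : mu.-integrable `[x0, y] (EFin \o f).
  apply: int_f; last exact: segment_compact.
  by move=> t /=; rewrite !in_itv /= andbT => /andP[].
have mf : measurable_fun ((`[x0, y] : set R) : set completed_type) f.
  by apply/measurable_EFinP; exact: measurable_int intf.
have mV : measurable_fun ((`[x0, y] : set R) : set completed_type) (fun t : R => t^-1).
  apply: completed_measurable_fun => //.
  apply: subspace_continuous_measurable_fun => //.
  apply: continuous_in_subspaceT => t; rewrite inE /= in_itv /= => /andP[xt _].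
  by apply: inv_continuous; rewrite gt_eqF // (lt_le_trans x0_gt0).
apply: (@le_integrable _ _ _ mu _ _ _ (fun t => (x0^-1)%:E * (f t)%:E)%E) => //.
- by apply/measurable_EFinP; exact: measurable_funM.
- move=> t /=; rewrite in_itv /= => /andP[xt _].
  have t0 : 0 < t by exact: lt_le_trans x0_gt0 xt.
  rewrite lee_fin !normrM mulrC ler_wpM2r // !gtr0_norm ?invr_gt0 //.
  by rewrite lef_pV2.
- by apply: integrableZl.
Qed.

Definition log_primitive x := \int[mu]_(t in `[x0, x]) (f t / t).

Section Increment.
Variables x y : R.
Hypotheses (x0x : x0 <= x) (xy : x <= y).

Let integrable_fdivU :
  mu.-integrable ([set` `[x0, x]] `|` [set` `]x, y]]) (EFin \o (fun t => f t / t)).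
Proof.
by rewrite -itv_bndbnd_setU ?bnd_simp //; exact: integrable_fdiv.
Qed.

Let integrable_fdiv_oc :
  mu.-integrable `]x, y] (EFin \o (fun t => f t / t)).
Proof. by apply: integrableS integrable_fdivU => //; exact: measurableU. Qed.

Let log_primitiveB :
  log_primitive y - log_primitive x = \int[mu]_(t in `]x, y]) (f t / t).
Proof.
rewrite /log_primitive (@itv_bndbnd_setU _ _ (BLeft x0) (BRight x) (BRight y)) ?bnd_simp //.
rewrite Rintegral_setU //; first by rewrite addrC addKr.
apply/disj_setPS => t [] /=; rewrite !in_itv /= => /andP[_ tx] /andP[xt _].
by move: (lt_le_trans xt tx); rewrite ltxx.
Qed.

Let integrable_cst r :
  mu.-integrable `]x, y] (EFin \o (fun _ : completed_type => r)).
Proof.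
apply: measurable_bounded_integrable => //.
  by rewrite [X in (X < _)%E](_ : _ = (y - x)%:E) ?ltry //; exact: completed_itv.
by exists `|r|; split; rewrite ?num_real // => z rz t _ /=; exact: ltW.
Qed.

Let int_cst r : \int[mu]_(t in `]x, y]) r = r * (y - x).
Proof.
rewrite Rintegral_cst //; congr (_ * _).
by rewrite [X in fine X](_ : _ = (y - x)%:E) //; exact: completed_itv.
Qed.

Lemma log_primitiveB_ge m : (forall t, x < t -> t <= y -> m <= f t / t) ->
  m * (y - x) <= log_primitive y - log_primitive x.
Proof.
move=> fm; rewrite -int_cst log_primitiveB; apply: le_Rintegral => // t /=.
by rewrite in_itv /= => /andP[]; exact: fm.
Qed.

Lemma log_primitiveB_le M : (forall t, x < t -> t <= y -> f t / t <= M) ->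
  log_primitive y - log_primitive x <= M * (y - x).
Proof.
move=> fM; rewrite -int_cst log_primitiveB; apply: le_Rintegral => // t /=.
by rewrite in_itv /= => /andP[]; exact: fM.
Qed.

End Increment.

End Primitive.

(** * Regular growth of the primitive *)

Section Regularity.
Variables (R : realType) (x0 : R) (f : R -> R).
Hypothesis x0_gt0 : 0 < x0.
Hypothesis f_gt0 : forall x, x0 <= x -> 0 < f x.
Hypothesis int_f : locally_integrable_on `[x0, +oo[ f.
Local Notation F := (log_primitive x0 f).

Lemma log_primitive_ge0 x : 0 <= F x.
Proof.
apply: Rintegral_ge0 => t /=; rewrite in_itv /= => /andP[xt _].
by rewrite divr_ge0 // ltW ?f_gt0 // (lt_le_trans x0_gt0).
Qed.

Variables (C X : R).
Hypothesis C1 : 1 <= C.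
Hypothesis X_ge : x0 <= X.
Hypothesis f_le : forall x, X <= x -> f x <= C * F x.
Hypothesis f_ge : forall x, X <= x -> F x <= C * f x.

Lemma log_primitive_mono x y : x0 <= x -> x <= y -> F x <= F y.
Proof.
move=> x0x xy; rewrite -subr_ge0 -[leLHS](mul0r (y - x)).
apply: (log_primitiveB_ge x0_gt0 int_f) => // t xt ty.
have x0t : x0 <= t by exact: le_trans x0x (ltW xt).
by rewrite divr_ge0 ?(le_trans _ x0t) // ltW // f_gt0.
Qed.

(** For [x < t <= 2 * x] the integrand is at least [F x / (C * (2 * x))], over an interval of length
    [x]. *)
Lemma log_primitive_grow x : X <= x -> (1 + (2 * C)^-1) * F x <= F (2 * x).
Proof.
move=> Xx; have x0x := le_trans X_ge Xx; have xp := lt_le_trans x0_gt0 x0x.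
have C0 := lt_le_trans ltr01 C1.
have xx : x <= 2 * x by lra.
rewrite mulrDl mul1r addrC -lerBrDr.
have -> : (2 * C)^-1 * F x = F x / (C * (2 * x)) * (2 * x - x).
  by field; rewrite !gt_eqF.
apply: (log_primitiveB_ge x0_gt0 int_f) => // t xt ty.
have tp := lt_trans xp xt; have Xt := le_trans Xx (ltW xt).
rewrite invfM mulrA; apply: ler_pM.
- by rewrite divr_ge0 ?log_primitive_ge0 // ltW.
- by rewrite invr_ge0 mulr_ge0 // ltW.
- rewrite ler_pdivrMr // mulrC (le_trans _ (f_ge Xt)) //.
  by rewrite log_primitive_mono // ltW.
- by rewrite lef_pV2 ?posrE // mulr_gt0.
Qed.

(** The length [x / (2 * C)] is such that the bound [C * F y / x] on the integrand contributes half
    of [F y], which is then absorbed on the left. *)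
Let step x : X <= x -> F ((1 + (2 * C)^-1) * x) <= 2 * F x.
Proof.
move=> Xx; have x0x := le_trans X_ge Xx; have xp := lt_le_trans x0_gt0 x0x.
have C0 := lt_le_trans ltr01 C1.
set y := _ * x.
have yx : y - x = (2 * C)^-1 * x by rewrite /y; ring.
have xy : x <= y by rewrite -subr_ge0 yx mulr_ge0 ?invr_ge0 ?mulr_ge0 // ltW.
suff : F y - F x <= F y / 2 by lra.
have -> : F y / 2 = C * F y / x * (y - x).
  by rewrite yx; field; rewrite !gt_eqF.
apply: (log_primitiveB_le x0_gt0 int_f) => // t xt ty.
have tp := lt_trans xp xt; have Xt := le_trans Xx (ltW xt).
apply: ler_pM.
- by rewrite ltW // f_gt0 // (le_trans X_ge).
- by rewrite invr_ge0 ltW.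
- rewrite (le_trans (f_le Xt)) // ler_wpM2l ?(ltW C0) //.
  by rewrite log_primitive_mono // (le_trans X_ge).
- by rewrite lef_pV2 ?posrE // ltW.
Qed.

(** [step] is iterated until the factor [(1 + e) ^+ k] reaches 2, with [k] given by Bernoulli's
    inequality. *)
Lemma log_primitive_double : exists2 D, 1 <= D &
  forall x, X <= x -> F (2 * x) <= D * F x.
Proof.
have C0 := lt_le_trans ltr01 C1.
set e := (2 * C)^-1; have e0 : 0 < e by rewrite invr_gt0 mulr_gt0.
have iter k x : X <= x -> F ((1 + e) ^+ k * x) <= 2 ^+ k * F x.
  move=> Xx; elim: k => [|k IH]; first by rewrite !expr0 !mul1r.
  have xp : 0 < x by rewrite (lt_le_trans x0_gt0) // (le_trans X_ge).
  rewrite !exprS -!mulrA (le_trans (step _)) ?ler_pM2l //.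
  rewrite (le_trans Xx) // ler_peMl ?(ltW xp) // exprn_ege1 //; lra.
pose k := Num.bound e^-1.
have ek : 2 <= (1 + e) ^+ k.
  have bern n : 1 + n%:R * e <= (1 + e) ^+ n.
    elim: n => [|n IH]; first by rewrite mul0r addr0.
    rewrite exprS (le_trans _ (ler_wpM2l _ IH)) //; last lra.
    rewrite -natr1; have : 0 <= n%:R :> R by []; nra.
  rewrite (le_trans _ (bern k)) // (_ : 2 = 1 + 1) // lerD2l.
  rewrite -ler_pdivrMr // div1r ltW // archi_boundP // invr_ge0 ltW //.
exists (2 ^+ k); first by rewrite exprn_ege1 // ler1n.
move=> x Xx; have xp : 0 < x by rewrite (lt_le_trans x0_gt0) // (le_trans X_ge).
rewrite (le_trans _ (iter k x Xx)) // log_primitive_mono //.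
  by have := le_trans X_ge Xx; lra.
by rewrite ler_pM2r.
Qed.

End Regularity.

(** * Back to the sets of tuples and the Landau notations *)

Section Bridge.
Variables (R : realType) (a : nat -> bool).
Let A : set nat := [set k | a k].

(** An explicit list of the representations, whose size obeys the recursion [repS]. *)
Fixpoint rep_seqs (h n : nat) : seq (seq nat) :=
  if h is h'.+1 then
    [seq k :: t | k <- [seq k <- iota 0 n.+1 | a k], t <- rep_seqs h' (n - k)%N]
  else if n == 0%N then [:: [::]] else [::].

Let rep_seqsS h n : rep_seqs h.+1 n =
  [seq k :: t | k <- [seq k <- iota 0 n.+1 | a k], t <- rep_seqs h (n - k)%N].
Proof. by []. Qed.

Lemma mem_rep_seqs h n t :
  (t \in rep_seqs h n) = [&& size t == h, all a t & sumn t == n].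
Proof.
elim: h n t => [|h IH] n t.
  case: t => [|x t] /=; case: (n =P 0%N) => n0; rewrite ?inE ?n0 //.
  by apply/esym/eqP => /esym.
rewrite rep_seqsS; apply/allpairsPdep/idP => [[k [u [+ + ->]]]|].
  rewrite mem_filter mem_iota /= ltnS => /andP[ak kn]; rewrite IH => /and3P[/eqP <- -> /eqP E].
  by rewrite eqxx ak /= E subnKC.
case: t => [|k u] // /and3P[/eqP[su] /andP[ak au] /eqP E].
exists k, u; split; last by [].
  by rewrite mem_filter ak mem_iota add0n ltnS -E /= leq_addr.
by rewrite IH su eqxx -E /= addKn eqxx andbT; exact: au.
Qed.

Lemma uniq_rep_seqs h n : uniq (rep_seqs h n).
Proof.
elim: h n => [|h IH] n; first by rewrite /=; case: eqP.
rewrite rep_seqsS; apply: allpairs_uniq_dep => [|k _|]; rewrite ?filter_uniq ?iota_uniq //.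
by move=> [x s] [y t] _ _ /= [-> ->].
Qed.

Lemma size_rep_seqs h n : (size (rep_seqs h n))%:R = rep R a h n.
Proof.
elim: h n => [|h IH] n; first by rewrite /= rep0; case: eqP.
rewrite rep_seqsS size_allpairs_dep sumnE big_map big_filter repS natr_sum.
rewrite -(big_mkord xpredT (fun k => (a k)%:R * rep R a h (n - k)%N)).
rewrite big_mkcond /= /index_iota subn0; apply: eq_bigr => k _.
by case: (a k); rewrite ?mul1r ?mul0r ?IH.
Qed.

Let representationsE h n :
  representations A h n = [set t : h.-tuple nat | val t \in rep_seqs h n].
Proof.
apply/seteqP; split => t /=; rewrite mem_rep_seqs size_tuple eqxx /=.
  move=> [At <-]; apply/andP; split.
    by apply/allP => x /tnthP[i ->]; apply: At.
  by rewrite sumnE big_tuple.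
move=> /andP[/allP At /eqP <-]; split => [i|].
  by apply: At; apply: mem_tnth.
by rewrite sumnE big_tuple.
Qed.

Let finite_representations h n : finite_set (representations A h n).
Proof.
rewrite representationsE; apply: (@finite_preimage _ _ [set` rep_seqs h n] val).
  by move=> x y _ _; apply: val_inj.
exact: finite_seq.
Qed.

Lemma rep_countE h n : (rep_count A h n)%:R = rep R a h n.
Proof.
rewrite -size_rep_seqs /rep_count; congr (_%:R).
rewrite -(size_map val); apply: perm_size; apply: uniq_perm.
- by rewrite map_inj_uniq ?fset_uniq //; apply: val_inj.
- exact: uniq_rep_seqs.
move=> t; apply/mapP/idP => [[u + ->]|].
  rewrite in_fset_set; last exact: finite_representations.
  by move=> /set_mem; rewrite representationsE.
move=> tr; have st : size t == h by move: tr; rewrite mem_rep_seqs => /and3P[].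
exists (Tuple st) => //.
rewrite in_fset_set; last exact: finite_representations.
by apply: mem_set; rewrite representationsE.
Qed.

Lemma counting_functionE (x : R) : 0 <= x ->
  (counting_function A x)%:R = cnt R a (Num.truncn x).
Proof.
move=> x0; rewrite /counting_function /cnt.
transitivity ((size [seq k <- iota 0 (Num.truncn x).+1 | a k])%:R : R); last first.
  rewrite size_filter -sum1_count natr_sum -(big_mkord xpredT (fun k => (a k)%:R : R)).
  by rewrite big_mkcond /index_iota subn0; apply: eq_bigr => k _; case: (a k).
set l := seq.filter _ _.
have ml k : (k \in l) = a k && (k%:R <= x).
  by rewrite mem_filter mem_iota leq0n add0n ltnS truncn_ge_nat.
have ul : uniq l by rewrite filter_uniq ?iota_uniq.
have AE : A `&` [set k | k%:R <= x] = [set` l].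
  move: (l) ml => m mm; apply/seteqP; split => k /=; rewrite mm.
    by move=> [ak ->]; rewrite andbT.
  by move=> /andP[].
congr (_%:R); apply: perm_size; apply: uniq_perm; rewrite ?fset_uniq //.
move=> k; rewrite in_fset_set AE; last exact: finite_seq.
by apply/idP/idP => [/set_mem|kl]; last apply: mem_set.
Qed.

Lemma sumsetP h n : sumset h A n <-> 0 < rep R a h n.
Proof.
rewrite -size_rep_seqs ltr0n; split.
  by move=> [t]; rewrite representationsE /=; case: (rep_seqs h n).
case E : (rep_seqs h n) => [//|t s] _.
have tr : t \in rep_seqs h n by rewrite E mem_head.
have st : size t == h by move: tr; rewrite mem_rep_seqs => /and3P[].
by exists (Tuple st); rewrite representationsE.
Qed.

End Bridge.

(** * Landau relations as explicit inequalities *)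

Section Asymptotics.
Variable R : realType.

Lemma eqO_pinfty (f g : R -> R) : f =O_ +oo g ->
  exists2 k, 0 < k & exists X, forall x, X <= x -> `|f x| <= k * `|g x|.
Proof.
move=> /eqO_exP[k k0 [X [_ H]]]; exists k => //; exists (X + 1) => x Xx.
by apply: H; lra.
Qed.

Lemma eqTheta_pinfty (f g : R -> R) : f =Theta_ +oo g <->
  exists2 k, 0 < k & exists X, forall x, X <= x -> `|f x| <= k * `|g x| /\ `|g x| <= k * `|f x|.
Proof.
rewrite eqThetaE bigThetaE eqOmegaO; split.
  move=> [/eqO_pinfty[k k0 [X H]] /eqO_pinfty[k' k'0 [X' H']]].
  exists (Num.max k k'); first by rewrite lt_max k0.
  exists (Num.max X X') => x; rewrite ge_max => /andP[/H le /H' le'].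
  by split; [apply: (le_trans le)|apply: (le_trans le')]; rewrite ler_wpM2r // le_max lexx ?orbT.
move=> [k k0 [X H]]; split; apply/eqO_exP; exists k => //; exists X; split;
  rewrite ?num_real // => x /ltW /H [] //.
Qed.

Lemma eqTheta_infty (u v : nat -> R) k N : 0 < k ->
  (forall n, (N <= n)%N -> `|u n| <= k * `|v n| /\ `|v n| <= k * `|u n|) ->
  u =Theta_ \oo v.
Proof.
move=> k0 H; rewrite eqThetaE bigThetaE eqOmegaO; split; apply/eqO_exP; exists k => //;
  by exists N => // n /H [].
Qed.

End Asymptotics.

(** * Growth conditions in power form *)

Section Hypotheses.
Variables (R : realType) (f : R -> R).

Lemma powR_exprK (x : R) h : (0 < h)%N -> 0 <= x -> (x `^ h%:R^-1) ^+ h = x.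
Proof.
move=> h0 x0; rewrite -powR_mulrn ?powR_ge0 // -powRrM mulVf ?powRr1 //.
by rewrite pnatr_eq0 -lt0n.
Qed.

Lemma dense_of_bigO h : (0 < h)%N ->
  (fun x => x `^ h%:R^-1 * ln x `^ h%:R^-1) =O_ +oo f ->
  exists2 k, 0 < k & exists X, forall x, X <= x -> x * ln x <= k * `|f x| ^+ h.
Proof.
move=> h0 /eqO_pinfty[k k0 [X H]]; exists (k ^+ h); first by rewrite exprn_gt0.
exists (Num.max X 1) => x; rewrite ge_max => /andP[/H le x1].
have x0 : 0 <= x by exact: le_trans ler01 x1.
have l0 : 0 <= ln x by apply: ln_ge0.
have -> : x * ln x = (x `^ h%:R^-1 * ln x `^ h%:R^-1) ^+ h.
  by rewrite exprMn !powR_exprK.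
rewrite -exprMn lerXn2r ?nnegrE ?mulr_ge0 ?powR_ge0 ?(ltW k0) //.
by rewrite (le_trans _ le) // ler_norm.
Qed.

(** The power [h1] of the bound on [f] has order [x] to the power [1 - h1 * eps]; the exponential
    factor supplies the missing power of [x]. *)
Lemma sparse_of_bigO h1 (eps : R) : (0 < h1)%N -> 0 < eps ->
  f =O_ +oo (fun x => x `^ (h1%:R^-1 - eps)) ->
  exists2 k, 0 < k & exists X, forall x, X <= x ->
    `|f x| <= k * x /\ `|f x| ^+ h1 * expR (h1%:R * eps * ln x) <= k * x.
Proof.
move=> h0 e0 /eqO_pinfty[k k0 [X H]].
exists (Num.max k (k ^+ h1)); first by rewrite lt_max k0.
exists (Num.max X 1) => x; rewrite ge_max => /andP[/H + x1].
have x0 : 0 < x by exact: lt_le_trans ltr01 x1.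
have l0 : 0 <= ln x by apply: ln_ge0.
have hR : 1 <= h1%:R :> R by rewrite ler1n.
rewrite (ger0_norm (powR_ge0 _ _)) /powR gt_eqF //.
set a := h1%:R^-1 - eps => le.
have h1V : h1%:R^-1 <= 1 :> R by rewrite invf_le1 // ltr0n.
split.
  rewrite (le_trans le) // (@le_trans _ _ (k * x)) //; last first.
    by rewrite ler_wpM2r ?(ltW x0) // le_max lexx.
  rewrite ler_pM2l // -[leRHS](lnK (_ : x \is Num.pos)) // ler_expR.
  by rewrite ler_piMl // /a; lra.
rewrite (@le_trans _ _ (k ^+ h1 * x)) //; last first.
  by rewrite ler_wpM2r ?(ltW x0) // le_max lexx orbT.
rewrite (@le_trans _ _ ((k * expR (a * ln x)) ^+ h1 * expR (h1%:R * eps * ln x))) //.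
  rewrite ler_wpM2r ?expR_ge0 // lerXn2r ?nnegrE //.
  by rewrite mulr_ge0 ?expR_ge0 // ltW.
rewrite exprMn -[leLHS]mulrA ler_pM2l ?exprn_gt0 // -expRM_natl -expRD.
rewrite -[leRHS](lnK (_ : x \is Num.pos)) // ler_expR le_eqVlt.
apply/orP; left; apply/eqP; rewrite /a; field.
by rewrite pnatr_eq0 -lt0n.
Qed.

End Hypotheses.

Theorem mainTheorem1 (R : realType) (h : nat) (x0 : R) (f : R -> R) :
  (2 <= h)%N ->
  0 < x0 ->
  (forall x, x0 <= x -> 0 < f x) ->
  locally_integrable_on `[x0, +oo[ f ->
  (fun x => \int[completed_lebesgue_measure]_(t in `[x0, x]) (f t / t)) =Theta_ +oo f ->
  ((fun x => x `^ h%:R^-1 * ln x `^ h%:R^-1) =O_ +oo f /\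
     (exists2 eps : R, 0 < eps & f =O_ +oo (fun x => x `^ ((h%:R - 1)^-1 - eps)))) \/
  [/\ h = 2%N,
      (fun x => x `^ 2^-1 * ln x `^ 2^-1) =O_ +oo f &
      f =O_ +oo (fun x => x)] ->
  exists A : set nat,
    [/\ basis_of_order h A,
        (fun x : R => (counting_function A x)%:R : R) =Theta_ +oo f &
        forall l : nat,
          (fun n : nat => (rep_count A (h + l) n)%:R : R) =Theta_ \oo
          (fun n : nat => f n%:R ^+ (h + l) / n%:R)].
Proof.
move=> h2 x0_gt0 f_gt0 int_f /eqTheta_pinfty[k0 k0_gt0 [X0 HF]] Hgrowth.
pose F := log_primitive x0 f.
have [h1 hE] : exists h1, h = h1.+1 by exists h.-1; lia.
have h1_gt0 : (0 < h1)%N by lia.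
have hm1 : h%:R - 1 = h1%:R :> R by rewrite hE -natr1 addrK.
have [kd kd_gt0 [Xd Hd]] : exists2 k, 0 < k & exists X, forall x, X <= x ->
    x * ln x <= k * `|f x| ^+ h.
  case: Hgrowth => [[Ha _]|[hh Ha _]]; apply: dense_of_bigO => //; first by lia.
    by lia.
  by rewrite hh.
have [ks ks_gt0 [e0 [e0_gt0 [Xs Hs]]]] : exists2 k, 0 < k & exists e0, 0 < e0 /\
    exists X, forall x, X <= x -> `|f x| <= k * x /\
      ((1 < h1)%N -> `|f x| ^+ h1 * expR (e0 * ln x) <= k * x).
  case: Hgrowth => [[_ [eps eps0]]|[hh _ /eqO_pinfty[k k_gt0 [X H]]]].
    rewrite hm1 => /(sparse_of_bigO h1_gt0 eps0)[k k_gt0 [X H]].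
    exists k => //; exists (h1%:R * eps); split; first by rewrite mulr_gt0 ?ltr0n.
    by exists X => x /H[].
  (* Here [h1 = 1]: the second bound has a false premise, and the exponent 1 is an arbitrary
     choice. *)
  exists k => //; exists 1; split=> //; exists (Num.max X 0) => x.
  rewrite ge_max => /andP[/H le xp]; split; last by lia.
  by rewrite (le_trans le) // ger0_norm.
pose C := Num.max 1 k0.
have C1 : 1 <= C by rewrite le_max lexx.
have C0 : 0 < C by exact: lt_le_trans ltr01 C1.
pose X := Num.max (Num.max x0 1) (Num.max X0 (Num.max Xd Xs)).
have [X_x0 X_1 X_X0 X_Xd X_Xs] : [/\ x0 <= X, 1 <= X, X0 <= X, Xd <= X & Xs <= X].
  by rewrite /X !le_max !lexx !orbT.
have f0 x : X <= x -> 0 < f x by move=> Xx; apply: f_gt0; apply: le_trans Xx.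
have F_ge0 x : 0 <= F x by exact: log_primitive_ge0.
have f_le x : X <= x -> f x <= C * F x.
  move=> Xx; have [_] := HF x (le_trans X_X0 Xx).
  rewrite -/(log_primitive x0 f x) -/(F x) !ger0_norm ?(ltW (f0 _ _)) // => le.
  by rewrite (le_trans le) // ler_wpM2r // le_max lexx orbT.
have f_ge x : X <= x -> F x <= C * f x.
  move=> Xx; have [+ _] := HF x (le_trans X_X0 Xx).
  rewrite -/(log_primitive x0 f x) -/(F x) !ger0_norm ?(ltW (f0 _ _)) // => le.
  by rewrite (le_trans le) // ler_wpM2r ?(ltW (f0 _ _)) // le_max lexx orbT.
have F0 x : X <= x -> 0 < F x.
  move=> Xx; have := lt_le_trans (f0 x Xx) (f_le x Xx).
  by rewrite pmulr_rgt0.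
have F_mono := log_primitive_mono x0_gt0 f_gt0 int_f.
have F_grow := log_primitive_grow x0_gt0 f_gt0 int_f C1 X_x0 f_ge.
have [D D1 F_double] := log_primitive_double x0_gt0 f_gt0 int_f C1 X_x0 f_le.
have D0 := lt_le_trans ltr01 D1.
pose N := Num.bound X.
have XN n : (N <= n)%N -> X <= n%:R.
  move=> Nn; rewrite (@le_trans _ _ N%:R) ?ler_nat // ltW // archi_boundP //.
  exact: le_trans ler01 X_1.
pose B := Num.max (kd * C ^+ h) (Num.max (C * ks) (C ^+ h1 * ks)).
have B0 : 0 < B by rewrite lt_max mulr_gt0 // exprn_gt0.
(* The sparsity condition of [exists_basis] has exponent [2 * e], to be kept at most [e0]. *)
pose e := Num.min 1 (e0 / 2).
have e01 : 0 < e <= 1 by rewrite lt_min ltr01 divr_gt0 //= ge_min lexx.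
have g01 : 0 < (2 * C)^-1 <= 1.
  rewrite invr_gt0 mulr_gt0 //= invf_le1 ?mulr_gt0 //.
  by rewrite (le_trans C1) // ler_peMl ?(ltW C0) // ler1n.
have [b [b_pos b_small [Cc Cc0 [Nc Hc]] b_rep]] : exists b : nat -> bool,
  [/\ forall n, 0 < rep R b h1.+1 n,
      forall k, (1 < k < h1.+1)%N -> exists n, rep R b k n < 1,
      exists2 C, 0 < C & exists N', forall n, (N' <= n)%N ->
        cnt R b n <= C * F n%:R /\ F n%:R <= C * cnt R b n &
      forall l, exists2 C, 0 < C & exists N', forall n, (N' <= n)%N ->
        rep R b (h1.+1 + l) n <= C * (F n%:R ^+ (h1.+1 + l) / n%:R) /\
        F n%:R ^+ (h1.+1 + l) / n%:R <= C * rep R b (h1.+1 + l) n].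
  apply: (@exists_basis R h1 (fun n => F n%:R) D (2 * C)^-1 e B N) => //.
  - by move=> n /XN/F0.
  - move=> m n /XN Xm mn; apply: F_mono; last by rewrite ler_nat.
    exact: le_trans X_x0 Xm.
  - by move=> n /XN Xn; rewrite natrM F_double.
  - by move=> n /XN Xn; rewrite natrM F_grow.
  - move=> n /XN Xn; have [le _] := Hs _ (le_trans X_Xs Xn).
    rewrite (le_trans (f_ge _ Xn)) // (@le_trans _ _ (C * ks * n%:R)) //.
      by rewrite -mulrA ler_pM2l // (le_trans _ le) // ler_norm.
    by rewrite ler_wpM2r // !le_max lexx !orbT.
  - move=> n /XN Xn; rewrite (le_trans (Hd _ (le_trans X_Xd Xn))) //.
    rewrite (@le_trans _ _ (kd * C ^+ h * F n%:R ^+ h)) //.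
      rewrite -mulrA ler_pM2l // -exprMn lerXn2r ?nnegrE ?mulr_ge0 ?(ltW C0) //.
      by rewrite gtr0_norm ?f0 // f_le.
    by rewrite hE ler_wpM2r ?exprn_ge0 // -hE le_max lexx.
  - move=> h1' n /XN Xn; have [_ /(_ h1') le] := Hs _ (le_trans X_Xs Xn).
    have n1 := le_trans X_1 Xn.
    rewrite (@le_trans _ _ (C ^+ h1 * (`|f n%:R| ^+ h1 * expR (e0 * ln n%:R)))) //.
      rewrite mulrA -exprMn; apply: ler_pM; rewrite ?exprn_ge0 ?expR_ge0 //.
        rewrite lerXn2r ?nnegrE ?mulr_ge0 ?(ltW C0) //.
        by rewrite gtr0_norm ?f0 // f_ge.
      rewrite ler_expR ler_wpM2r ?ln_ge0 //.
      have : e <= e0 / 2 by rewrite ge_min lexx orbT.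
      lra.
    rewrite (@le_trans _ _ (C ^+ h1 * ks * n%:R)) //.
      by rewrite -mulrA ler_pM2l ?exprn_gt0.
    by rewrite ler_wpM2r // !le_max lexx !orbT.
rewrite -hE in b_pos b_small b_rep.
exists [set k | b k]; split.
- split=> //.
  (* If all elements were at most [m], then [(h * m).+1] would have no representation. *)
  + move=> /finite_seqP[s sE].
    pose m := \max_(i <- s) i.
    have bm i : b i -> (i <= m)%N.
      move=> bi; apply: leq_bigmax_seq => //.
      by have : [set k | b k] i by []; rewrite sE.
    have := b_pos (h * m).+1; rewrite (rep_gt_support _ bm) ?ltxx //.
  + by apply/seteqP; split => // n _; apply/(sumsetP R).
  + move=> k kh kT; have [n lt1] := b_small k kh.
    have : sumset k [set k | b k] n by rewrite kT.
    move=> /(sumsetP R); rewrite -size_rep_seqs ltr0n -(ler1n R) leNgt.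
    by rewrite size_rep_seqs lt1.
- apply/eqTheta_pinfty; exists (Cc * C * D); first by rewrite !mulr_gt0.
  exists (Num.max X (N + Nc + 1)%:R) => x; rewrite ge_max => /andP[Xx Nx].
  have x1 := le_trans X_1 Xx; have xp := le_trans ler01 x1.
  (* The real [x] is compared with its integer part: as [m <= x <= 2 * m], [F x] lies between [F m]
     and [D * F m]. *)
  pose m := Num.truncn x.
  have /andP[mx xm] : m%:R <= x < m.+1%:R by exact: truncn_itv.
  have mN : (N + Nc + 1 <= m)%N by rewrite truncn_ge_nat.
  have Xm : X <= m%:R by apply: XN; rewrite (leq_trans _ mN) // -addnA leq_addr.
  have Ncm : (Nc <= m)%N by rewrite (leq_trans _ mN) // addnAC leq_addl.
  have m1 : (0 < m)%N by rewrite (leq_trans _ mN) // addn1.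
  have [le1 le2] := Hc m Ncm.
  have Fm1 : F m%:R <= F x by apply: F_mono => //; exact: le_trans X_x0 Xm.
  have Fm2 : F x <= D * F m%:R.
    rewrite (le_trans _ (F_double _ Xm)) // F_mono ?(le_trans X_x0 Xx) //.
    by rewrite (le_trans (ltW xm)) // -natrM ler_nat mul2n -addnn -addn1 leq_add2l.
  rewrite (counting_functionE b xp) -/m !ger0_norm ?cnt_ge0 ?(ltW (f0 _ _)) //.
  have CC0 : 0 < Cc * C by rewrite mulr_gt0.
  have fx0 := f0 x Xx; have cm0 := cnt_ge0 R b m.
  split.
    rewrite (le_trans le1) // (@le_trans _ _ (Cc * (C * f x))) //.
      by rewrite ler_pM2l // (le_trans Fm1) // f_ge.
    by rewrite mulrA ler_pM2r // ler_peMr // ltW.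
  rewrite (le_trans (f_le x Xx)) // (@le_trans _ _ (C * (D * (Cc * cnt R b m)))) //.
    by rewrite ler_pM2l // (le_trans Fm2) // ler_pM2l.
  by rewrite le_eqVlt; apply/orP; left; apply/eqP; ring.
- move=> l; have [Cl Cl0 [Nl Hl]] := b_rep l.
  apply: (@eqTheta_infty _ _ _ (Cl * C ^+ (h + l)) (N + Nl)%N).
    by rewrite mulr_gt0 // exprn_gt0.
  move=> n Nn; have Xn : X <= n%:R by apply: XN; exact: leq_trans (leq_addr _ _) Nn.
  have [le1 le2] := Hl n (leq_trans (leq_addl _ _) Nn).
  have fn0 := f0 _ Xn; have Fn0 := F_ge0 n%:R.
  rewrite rep_countE !ger0_norm ?rep_ge0 ?divr_ge0 ?exprn_ge0 ?(ltW fn0) //.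
  have Cp : 0 < C ^+ (h + l) by rewrite exprn_gt0.
  split.
    rewrite (le_trans le1) // -[leRHS]mulrA ler_pM2l // mulrA -exprMn.
    rewrite ler_wpM2r ?invr_ge0 // lerXn2r ?nnegrE ?mulr_ge0 ?(ltW C0) ?(ltW fn0) //.
    exact: f_ge.
  rewrite (@le_trans _ _ (C ^+ (h + l) * (F n%:R ^+ (h + l) / n%:R))) //.
    rewrite mulrA -exprMn ler_wpM2r ?invr_ge0 // lerXn2r ?nnegrE ?mulr_ge0 ?(ltW C0) ?(ltW fn0) //.
    exact: f_le.
  by rewrite [Cl * _]mulrC -mulrA ler_pM2l.
Qed.
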